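(* Let $\mathbf A$ be a real $n\times n$ matrix. The following are equivalent: (1) $\mathbf A$ has the total signature equality property; (2) for every $j=1,\dots,n$, $\mathbf A^{(j)}$ has the signature equality property; (3) for every $j=1,\dots,n$, $\mathbf A^{(j)}$ is eventually SJS; (4) $\mathbf A$ is eventually strictly totally $J$-sign-symmetric.
   Context: The $j$th compound matrix $\mathbf A^{(j)}$ is the $\binom nj\times\binom nj$ matrix of all $j\times j$ minors of $\mathbf A$ with row and column index sets in lexicographic order. For $x_1,\dots,x_j\in\mathbb R^n$, the exterior product $x_1\wedge\dots\wedge x_j\in\mathbb R^{\binom nj}$ has as coordinate number $\alpha$ the determinant $\det(x_s^{i_r})_{r,s=1}^j$, where $(i_1<\dots<i_j)$ is the $\alpha$th index set in lexicographic order. For $x\in\mathbb R^m$, $\mathrm{Sign}(x)=(\mathrm{sgn}(x^1),\dots,\mathrm{sgn}(x^m))$. An eigenfunctional of a matrix for eigenvalue $\lambda$ is an eigenvector of its transpose for $\lambda$. For a real $m\times m$ matrix $\mathbf B=\{b_{ij}\}$ and $J\subseteq[m]$, $J^c=[m]\setminus J$, $\mathbf B$ is strictly $J$-sign-symmetric if $b_{ij}>0$ on $(J\times J)\cup(J^c\times J^c)$ and $b_{ij}<0$ on $(J\times J^c)\cup(J^c\times J)$; $\mathbf B$ is SJS if this holds for some $J\subseteq[m]$; $\mathbf B$ is eventually SJS if there is $k_0$ with $\mathbf B^k$ SJS for all $k\ge k_0$. $\mathbf B$ has the signature equality property if it has a simple positive eigenvalue $\lambda$ with $\lambda>|\mu|$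 for every other eigenvalue $\mu$, whose eigenvector $x$ and eigenfunctional $x^*$ have no zero coordinates and can be chosen with $\mathrm{Sign}(x)=\mathrm{Sign}(x^* )$. $\mathbf A$ is strictly totally $J$-sign-symmetric (STJS) if for every $j=1,\dots,n$ the matrix $\mathbf A^{(j)}$ is SJS (with respect to some subset of its index set $[\binom nj]$); $\mathbf A$ is eventually STJS if there is $k_0$ with $\mathbf A^k$ STJS for all $k\ge k_0$. $\mathbf A$ has the total signature equality property if it has $n$ positive simple eigenvalues $\lambda_1>\dots>\lambda_n>0$ whose eigenvectors $x_1,\dots,x_n$ and eigenfunctionals $x_1^*,\dots,x_n^*$ can be chosen so that for all $j=1,\dots,n$, $x_1\wedge\dots\wedge x_j$ and $x_1^*\wedge\dots\wedge x_j^*$ have no zero coordinates and $\mathrm{Sign}(x_1\wedge\dots\wedge x_j)=\mathrm{Sign}(x_1^*\wedge\dots\wedge x_j^* )$. *)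

(* Defs.v *)
From mathcomp Require Import all_boot all_order all_algebra.
From mathcomp Require Import reals complex.
Set Implicit Arguments. Unset Strict Implicit. Unset Printing Implicit Defensive.
Import Order.TTheory GRing.Theory Num.Theory.
Local Open Scope ring_scope.
Local Open Scope complex_scope.

Fixpoint lexle (s t : seq nat) : bool :=
  match s, t with
  | [::], _ => true
  | _ :: _, [::] => false
  | x :: s', y :: t' => (x < y)%N || ((x == y) && lexle s' t')
  end.

(* The j-element index sets (i_1 < ... < i_j) of [n], as increasing
   j-tuples, listed in lexicographic order.  Its size is 'C(n, j). *)
Definition index_sets (n j : nat) : seq (j.-tuple 'I_n) :=
  sort (fun s t : j.-tuple 'I_n => lexle (map (@nat_of_ord n) (tval s)) (map (@nat_of_ord n) (tval t)))
       [seq t <- enum {: j.-tuple 'I_n} | sorted ltn (map (@nat_of_ord n) (tval t))].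

Definition nsets (n j : nat) : nat := size (index_sets n j).

Definition iset (n j : nat) (a : 'I_(nsets n j)) : j.-tuple 'I_n :=
  tnth (in_tuple (index_sets n j)) a.

Definition compound (R : comNzRingType) (n : nat) (A : 'M[R]_n) (j : nat)
  : 'M[R]_(nsets n j) :=
  \matrix_(a, b) \det (\matrix_(r < j, s < j) A (tnth (iset a) r) (tnth (iset b) s)).

Definition wedge (R : comNzRingType) (n j : nat) (x : 'I_j -> 'cV[R]_n)
  : 'cV[R]_(nsets n j) :=
  \col_a \det (\matrix_(r < j, s < j) x s (tnth (iset a) r) 0).

Definition nozero_same_sign (R : realDomainType) (m : nat) (x y : 'cV[R]_m) :=
  forall i, x i 0 != 0 /\ y i 0 != 0 /\ Num.sg (x i 0) = Num.sg (y i 0).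

Definition ceigenvalue (R : realType) (m : nat) (B : 'M[R]_m) (mu : R[i]) :=
  root (map_poly (fun x : R => x%:C) (char_poly B)) mu.

Definition simple_eigenvalue (R : realType) (m : nat) (B : 'M[R]_m) (l : R) :=
  mup l (char_poly B) = 1%N.

Definition is_eigenvector (R : realType) (m : nat) (B : 'M[R]_m) (l : R)
  (x : 'cV[R]_m) := x != 0 /\ B *m x = l *: x.

Definition is_eigenfunctional (R : realType) (m : nat) (B : 'M[R]_m) (l : R)
  (x : 'cV[R]_m) := is_eigenvector B^T l x.

Definition SJS_wrt (R : realDomainType) (m : nat) (B : 'M[R]_m) (J : {set 'I_m}) :=
  forall i k, if (i \in J) == (k \in J) then 0 < B i k else B i k < 0.

Definition SJS (R : realDomainType) (m : nat) (B : 'M[R]_m) :=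
  exists J : {set 'I_m}, SJS_wrt B J.

Definition eventually_SJS (R : realDomainType) (m : nat) (B : 'M[R]_m) :=
  exists k0 : nat, forall k : nat, (k0 <= k)%N -> SJS (B ^+ k).

Definition signature_equality (R : realType) (m : nat) (B : 'M[R]_m) :=
  exists l : R,
    [/\ 0 < l, simple_eigenvalue B l, ceigenvalue B l%:C,
        (forall mu : R[i], ceigenvalue B mu -> mu != l%:C -> `|mu| < l%:C) &
        exists x y : 'cV[R]_m,
          [/\ is_eigenvector B l x, is_eigenfunctional B l y &
              nozero_same_sign x y]].

Definition STJS (R : realDomainType) (n : nat) (A : 'M[R]_n) :=
  forall j : nat, (0 < j <= n)%N -> SJS (compound A j).

Definition eventually_STJS (R : realDomainType) (n : nat) (A : 'M[R]_n) :=
  exists k0 : nat, forall k : nat, (k0 <= k)%N -> STJS (A ^+ k).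

Definition first_vecs (R : comNzRingType) (n j : nat) (hj : (j <= n)%N)
  (x : 'I_n -> 'cV[R]_n) : 'I_j -> 'cV[R]_n :=
  fun s => x (widen_ord hj s).

Definition total_signature_equality (R : realType) (n : nat) (A : 'M[R]_n) :=
  exists (l : 'I_n -> R) (x xs : 'I_n -> 'cV[R]_n),
    [/\ (forall i, 0 < l i),
        (forall i k : 'I_n, (i < k)%N -> l k < l i),
        (forall i, simple_eigenvalue A (l i)),
        (forall i, is_eigenvector A (l i) (x i) /\
                   is_eigenfunctional A (l i) (xs i)) &
        (forall j (hj : (j <= n)%N), (0 < j)%N ->
          nozero_same_sign (wedge (first_vecs hj x)) (wedge (first_vecs hj xs)))].

(* Main.v *)
Require Import Defs.
From mathcomp Require Import all_boot all_order all_fingroup all_algebra.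
From mathcomp Require Import reals complex spectral.
From mathcomp Require Import ring lra.
Import Order.TTheory GRing.Theory Num.Theory.
Import ComplexField.Normc.
Set Implicit Arguments. Unset Strict Implicit. Unset Printing Implicit Defensive.
Local Open Scope ring_scope.
Local Open Scope complex_scope.

(** By Cauchy-Binet, [compound] is multiplicative, and over the complex numbers a
    Schur triangularization of [A] makes each compound triangular: the eigenvalues
    of the [j]-th compound are the products of [j] eigenvalues of [A].

    (1) => (2): the dominant eigenvalue of the [j]-th compound is
    [l_1 * ... * l_j], with eigenvectors the two wedge products.
    (2) => (3): subtracting from [B] the rank one matrix [l x y^T / (y^T x)] replaces
    the eigenvalue [l] by [0], so [B^k / l^k] tends to [x y^T / (y^T x)], whose sign
    pattern is strictly J-sign-symmetric.
    (4) => (1): a strictly J-sign-symmetric matrix is signature-similar to a positive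
    one. Perron's theorem for the compounds of [A^k] forces the product of the [j]
    eigenvalues of [A] of largest modulus to be simple, positive and strictly
    dominant for every [j], so the eigenvalues of [A] are positive and distinct; the
    wedge products of eigenvectors are the Perron vectors, and the signs of the
    eigenfunctionals are adjusted one after the other. *)

(** * Powers of a matrix and its spectral radius *)

(** A Bernoulli bound: the left side does not increase with [k], because with [h = 1 - q] the
    difference [1 + k h - q (1 + (k + 1) h)] equals [(k + 1) h^2]. *)
Lemma geometric_le (R : realFieldType) (q : R) (k : nat) :
  0 <= q -> q <= 1 -> q ^+ k * (1 + k%:R * (1 - q)) <= 1.
Proof.
move=> q0 q1; elim: k => [|k IH]; first by rewrite mul0r addr0 mulr1.
apply: le_trans IH; rewrite exprSr -mulrA ler_wpM2l ?exprn_ge0 //.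
have k0 : 0 <= k%:R :> R by [].
rewrite -natr1; have := mulr_ge0 k0 (sqr_ge0 (1 - q)); have := sqr_ge0 (1 - q).
by lra.
Qed.

Lemma geometric_small (R : realType) (q C e : R) :
  0 <= q -> q < 1 -> 0 < e -> exists N, forall k, (N <= k)%N -> q ^+ k * C <= e.
Proof.
move=> q0 q1 e0.
have h0 : 0 < 1 - q by rewrite subr_gt0.
have eh0 : 0 < e * (1 - q) by rewrite mulr_gt0.
(* Beyond this threshold [|C|] is at most [e * (1 + k%:R * (1 - q))], and the second factor is
   absorbed by [geometric_le]. *)
exists (Num.bound (`|C| / (e * (1 - q)))) => k Nk.
have Ck : `|C| <= e * (1 + k%:R * (1 - q)).
  have : `|C| / (e * (1 - q)) < k%:R.
    by apply: lt_le_trans (archi_boundP _) _; rewrite ?ler_nat // divr_ge0 // ltW.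
  by rewrite ltr_pdivrMr // => /ltW /le_trans; apply; lra.
have qk0 : 0 <= q ^+ k by rewrite exprn_ge0.
apply: (@le_trans _ _ (q ^+ k * `|C|)); first by rewrite ler_wpM2l // ler_norm.
apply: (le_trans (ler_wpM2l qk0 Ck)).
by rewrite mulrCA -[leRHS]mulr1 ler_wpM2l ?geometric_le // ltW.
Qed.

(** Once [b] stays below [e / 2 * (1 - q)], the recurrence is dominated by an affine map of ratio
    [q] with fixed point [e / 2], so [a] exceeds [e / 2] by at most a geometric term. *)
Lemma recurrence_small (R : realType) (a b : nat -> R) (q : R) :
  0 <= q -> q < 1 -> (forall k, a k.+1 <= q * a k + b k) ->
  (forall e, 0 < e -> exists N, forall k, (N <= k)%N -> b k <= e) ->
  forall e, 0 < e -> exists N, forall k, (N <= k)%N -> a k <= e.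
Proof.
move=> q0 q1 rec b_small e e0.
have h0 : 0 < 1 - q by rewrite subr_gt0.
have [|N bN] := b_small (e / 2 * (1 - q)); first by rewrite !mulr_gt0 ?invr_gt0.
have [|N' qN'] := @geometric_small _ q (a N) (e / 2) q0 q1; first by lra.
exists (N + N')%N => k Nk.
have bound i : a (N + i)%N <= q ^+ i * a N + e / 2.
  elim: i => [|i IH]; first by rewrite addn0 mul1r; lra.
  rewrite addnS; apply: le_trans (rec _) _.
  have := bN _ (leq_addr i N); have := ler_wpM2l q0 IH; rewrite exprS; lra.
have -> : k = (N + (k - N))%N by rewrite subnKC // (leq_trans _ Nk) // leq_addr.
have : q ^+ (k - N) * a N <= e / 2 by apply: qN'; rewrite leq_subRL // (leq_trans _ Nk) // leq_addr.
by have := bound (k - N)%N; lra.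
Qed.

Section ComplexPowers.
Variable R : realType.
Implicit Types (mu : R[i]) (r e : R).

Lemma complex_normE mu : `|mu| = (normc mu)%:C. Proof. by []. Qed.

Lemma normc_ge0 mu : 0 <= normc mu.
Proof. by rewrite -lecR -complex_normE normr_ge0. Qed.

Lemma normcX mu k : normc (mu ^+ k) = normc mu ^+ k.
Proof. by elim: k => [|k IH]; rewrite ?normc1 // !exprS normcM IH. Qed.

Lemma normc_real r : normc r%:C = `|r|.
Proof. by rewrite /normc /= expr0n /= addr0 sqrtr_sqr. Qed.

Lemma normc_le_sum (I : finType) (F : I -> R[i]) :
  normc (\sum_i F i) <= \sum_i normc (F i).
Proof.
elim/big_ind2: _ => [|x1 x2 y1 y2 h1 h2|//]; first by rewrite normc0.
by apply: le_trans (le_normcD _ _) _; rewrite lerD.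
Qed.

(** This is [u k = o(r ^+ k)], stated without division. *)
Definition small_wrt r (u : nat -> R[i]) :=
  forall e, 0 < e -> exists N, forall k, (N <= k)%N -> normc (u k) <= e * r ^+ k.

(** Divided by the powers of [r], the moduli satisfy a recurrence of ratio [normc mu / r < 1] whose
    forcing term tends to 0. *)
Lemma small_wrt_shift r mu u : 0 < r -> normc mu < r ->
  small_wrt r (fun k => u k.+1 - mu * u k) -> small_wrt r u.
Proof.
move=> r0 mur u_small e e0.
pose a k := normc (u k) / r ^+ k; pose b k := normc (u k.+1 - mu * u k) / r ^+ k.+1.
have rk k : 0 < r ^+ k by rewrite exprn_gt0.
have q0 : 0 <= normc mu / r by rewrite divr_ge0 ?normc_ge0 ?ltW.
have q1 : normc mu / r < 1 by rewrite ltr_pdivrMr ?mul1r.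
have rec k : a k.+1 <= normc mu / r * a k + b k.
  rewrite /a /b mulrACA -invfM -exprS -mulrDl ler_pM2r ?invr_gt0 //.
  by rewrite -normcM; apply: le_trans (le_normcD _ _); rewrite addrCA subrr addr0.
have b_small e' : 0 < e' -> exists N, forall k, (N <= k)%N -> b k <= e'.
  move=> e'0; have [|N uN] := u_small (e' * r); first by rewrite mulr_gt0.
  exists N => k Nk; rewrite /b ler_pdivrMr // exprS mulrA; exact: uN.
have [N aN] := recurrence_small q0 q1 rec b_small e0.
by exists N => k Nk; rewrite -ler_pdivrMr //; apply: aN.
Qed.

(* Induction on the list of eigenvalues: [G * (M - mu) * M^k] being small makes
   [G * M^k] a solution of a first order recurrence of ratio [mu]. *)
Lemma annihilated_powers_small m (M : 'M[R[i]]_m.+1) r (s : seq R[i]) :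
  0 < r -> {in s, forall mu, normc mu < r} -> forall G : 'M_m.+1,
  G *m \prod_(mu <- s) (M - mu%:M) = 0 ->
  forall i j, small_wrt r (fun k => (G *m M ^+ k) i j).
Proof.
move=> r0; elim: s => [_ G|mu s IH s_lt G].
  rewrite big_nil mulmx1 => -> i j e e0; exists 0%N => k _.
  by rewrite mul0mx mxE normc0 mulr_ge0 ?exprn_ge0 // ltW.
rewrite big_cons mulmxA => /IH G_small i j.
apply: (@small_wrt_shift _ mu) => //; first by rewrite s_lt ?mem_head.
have {}G_small := G_small (fun nu hnu => s_lt nu (@mem_behead _ (mu :: s) nu hnu)) i j.
move=> e /G_small [N GN]; exists N => k /GN; congr (normc _ <= _).
by rewrite mulmxBr mulmxBl exprS mulmxA mul_mx_scalar -scalemxAl !mxE.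
Qed.

(** Cayley-Hamilton makes the product of the [M - mu%:M] over all roots vanish, which is the
    annihilation hypothesis with [G = 1]; no Jordan form is involved. The maximum over the finitely
    many entries makes the threshold uniform. *)
Lemma powers_small m (M : 'M[R[i]]_m) r : 0 < r ->
  (forall mu, root (char_poly M) mu -> normc mu < r) ->
  forall e, 0 < e -> exists N, forall k i j, (N <= k)%N ->
  normc ((M ^+ k) i j) <= e * r ^+ k.
Proof.
case: m M => [M _ _ e _|m M r0 Mr e e0]; first by exists 0%N => k [].
have [s Ms] := closed_field_poly_normal (char_poly M).
rewrite (monicP (char_poly_monic M)) scale1r in Ms.
have s_lt : {in s, forall mu, normc mu < r}.
  by move=> mu smu; apply: Mr; rewrite Ms root_prod_XsubC.
have M0 : 1%:M *m \prod_(mu <- s) (M - mu%:M) = 0.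
  rewrite mul1mx -(Cayley_Hamilton M) Ms rmorph_prod; apply: eq_bigr => mu _.
  by rewrite rmorphB /= horner_mx_X horner_mx_C.
have {}M0 (p : 'I_m.+1 * 'I_m.+1) : exists N, forall k, (N <= k)%N ->
    normc ((M ^+ k) p.1 p.2) <= e * r ^+ k.
  have [N MN] := annihilated_powers_small r0 s_lt M0 p.1 p.2 e0.
  by exists N => k /MN; rewrite mul1mx.
have [N MN] := fin_all_exists M0.
exists (\max_p N p)%N => k i j Nk; apply: (MN (i, j)).
by apply: leq_trans Nk; apply: (leq_bigmax (i, j)).
Qed.

Lemma map_mxXn m (B : 'M[R]_m) k :
  map_mx (real_complex R) (B ^+ k) = map_mx (real_complex R) B ^+ k.
Proof. by elim: k => [|k IH]; rewrite ?map_mx1 // !exprS map_mxM IH. Qed.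

Lemma real_powers_small m (B : 'M[R]_m) r : 0 < r ->
  (forall mu, ceigenvalue B mu -> normc mu < r) ->
  forall e, 0 < e -> exists N, forall k i j, (N <= k)%N ->
  `|(B ^+ k) i j| <= e * r ^+ k.
Proof.
move=> r0 Br e e0.
have [|N BN] := @powers_small m (map_mx (real_complex R) B) r r0 _ e e0.
  by move=> mu; rewrite -map_char_poly => /Br.
by exists N => k i j /BN -/(_ i j); rewrite -map_mxXn mxE normc_real.
Qed.

End ComplexPowers.

(** * Rank one deflation *)

Section Deflation.
Variable F : fieldType.

(** The matrix determinant lemma, multiplied by [s] so that [s] need not be invertible. The bordered
    matrix [M] has determinant [\det (s%:M + u *m v)] by the factorization [Ml], and [Mr] relates it
    to [s + v *m u]. *)
Lemma det_scalar_rank1 (A : comNzRingType) m (s : A) (u : 'cV[A]_m) (v : 'rV[A]_m) :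
  \det (s%:M + u *m v) * s = (s + (v *m u) 0 0) * s ^+ m.
Proof.
pose M := block_mx (1%:M : 'M_1) (- v) u s%:M.
have Ml : M = block_mx (1%:M : 'M_1) 0 u 1%:M
            *m block_mx 1%:M (- v) 0 (s%:M + u *m v).
  by rewrite mulmx_block !(mulmx1, mul1mx, mul0mx, mulmx0, addr0, mulmxN)
             addrC addrK.
have Mr : M *m block_mx (s%:M : 'M_1) 0 (- u) 1%:M
        = block_mx (s%:M + v *m u) (- v) 0 s%:M.
  rewrite mulmx_block !(mulmx1, mul1mx, mul0mx, mulmx0, addr0, mulmxN, mulNmx, add0r, opprK).
  by rewrite mul_mx_scalar mul_scalar_mx subrr.
have := congr1 determinant Mr; rewrite det_mulmx Ml det_mulmx.
rewrite !det_lblock !det_ublock !det1 !det_scalar !mul1r !mulr1 expr1 => ->.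
by rewrite det_mx11 !mxE mulr1n.
Qed.

(** A rank one change along an eigenvector moves the eigenvalue [l] to [l - t] and keeps all others
    with multiplicity. Since [char_poly_mx B] multiplies [x] by [s = 'X - l%:P], the deflated
    characteristic matrix times [s] factors through [s%:M + xP *m yP], whose determinant is
    known. *)
Lemma char_poly_deflate m (B : 'M[F]_m) (l t : F) (x : 'cV[F]_m) (y : 'rV[F]_m) :
  B *m x = l *: x -> (y *m x) 0 0 = 1 ->
  ('X - l%:P) * char_poly (B - t *: (x *m y)) = char_poly B * ('X - (l - t)%:P).
Proof.
move=> Bx yx; set s := 'X - l%:P.
have s0 : s != 0 by rewrite polyXsubC_eq0.
pose xP := map_mx polyC (t *: x); pose yP := map_mx polyC y.
have eigen : char_poly_mx B *m xP = s *: xP.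
  rewrite /char_poly_mx mulmxBl mul_scalar_mx -map_mxM -scalemxAr Bx scalerBl.
  by congr (_ - _); rewrite scalerA mulrC -scalerA map_mxZ.
have shift : s *: char_poly_mx (B - t *: (x *m y))
    = char_poly_mx B *m (s%:M + xP *m yP).
  rewrite mulmxDr mulmxA eigen mul_mx_scalar -scalemxAl -scalerDr; congr (_ *: _).
  by rewrite /char_poly_mx map_mxB opprB -map_mxM -scalemxAl addrA addrAC.
have := congr1 determinant shift; rewrite detZ det_mulmx => dets.
have rank1 := det_scalar_rank1 s xP yP.
apply: (mulfI (expf_neq0 m s0)).
rewrite mulrCA dets mulrCA [s * _]mulrC rank1 /char_poly mulrA mulrC.
congr (_ * (_ * _)).
have -> : (yP *m xP) 0 0 = t%:P.
  by rewrite -map_mxM -scalemxAr mxE; congr _%:P; rewrite mxE yx mulr1.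
by rewrite /s polyCB opprB addrA addrAC.
Qed.

Lemma char_poly_trmx (A : comNzRingType) m (B : 'M[A]_m) : char_poly B^T = char_poly B.
Proof.
rewrite -[RHS]det_tr; congr (\det _).
by rewrite /char_poly_mx linearB /= tr_scalar_mx map_trmx.
Qed.

Lemma root_char_polyP m (B : 'M[F]_m) l :
  reflect (exists2 x : 'cV_m, x != 0 & B *m x = l *: x) (root (char_poly B) l).
Proof.
rewrite -char_poly_trmx -eigenvalue_root_char; apply: (iffP idP) => [/eigenvalueP|].
  move=> [v vB v0]; exists v^T; first by rewrite trmx_eq0.
  by apply: trmx_inj; rewrite trmx_mul !trmxK linearZ /= trmxK.
move=> [x x0 Bx]; apply/eigenvalueP; exists x^T; last by rewrite trmx_eq0.
by rewrite -trmx_mul Bx linearZ.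
Qed.

End Deflation.

(** * Perron's theorem *)

Section Perron.
Variable R : realType.

Lemma finite_lower_bound (I : finType) (F : I -> R) :
  (forall i, 0 < F i) -> exists2 t, 0 < t & forall i, t <= F i.
Proof.
move=> F0; have S0 : 0 <= \sum_i (F i)^-1 by apply: sumr_ge0 => i _; rewrite invr_ge0 ltW.
have S1 : 0 < 1 + \sum_i (F i)^-1 by lra.
(* The added 1 keeps the bound positive when [I] is empty. *)
exists (1 + \sum_i (F i)^-1)^-1; first by rewrite invr_gt0.
move=> i; rewrite -[leRHS]invrK lef_pV2 ?posrE ?invr_gt0 // (bigD1 i) //= addrCA.
by rewrite lerDl addr_ge0 ?sumr_ge0 // => k _; rewrite invr_ge0 ltW.
Qed.

Lemma pos_mulmx_gt0 m (P : 'M[R]_m) (u : 'cV[R]_m) :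
  (forall i j, 0 < P i j) -> (forall i, 0 <= u i 0) -> u != 0 ->
  forall i, 0 < (P *m u) i 0.
Proof.
move=> P0 u0 /cV0Pn [k uk] i; rewrite mxE (bigD1 k) //=.
have uk0 : 0 < u k 0 by rewrite lt_neqAle eq_sym uk u0.
rewrite ltr_pwDl ?mulr_gt0 //.
by apply: sumr_ge0 => j _; rewrite mulr_ge0 // ltW.
Qed.

(** Iterating the inequality gives [P ^+ k *m w >= r ^+ k *: w] entrywise, while the powers of [P]
    are [o(r ^+ k)]. *)
Lemma no_super_eigenvector m (P : 'M[R]_m) (r : R) (w : 'cV[R]_m) (i0 : 'I_m) :
  (forall i j, 0 <= P i j) -> 0 < r -> (forall i, 0 < w i 0) ->
  (forall mu, ceigenvalue P mu -> normc mu < r) ->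
  ~ (forall i, r * w i 0 <= (P *m w) i 0).
Proof.
move=> P0 r0 w0 P_lt Pw.
have Pk k i : r ^+ k * w i 0 <= (P ^+ k *m w) i 0.
  elim: k i => [|k IH] i; first by rewrite mul1r mul1mx.
  rewrite exprSr exprS -mulmxA [leRHS]mxE -mulrA.
  apply: (le_trans (ler_wpM2l (exprn_ge0 k (ltW r0)) (Pw i))).
  rewrite mxE mulr_sumr; apply: ler_sum => j _.
  by rewrite mulrCA ler_wpM2l.
have S0 : 0 < \sum_i w i 0.
  by rewrite (bigD1 i0) //= ltr_pwDl // sumr_ge0 // => i _; rewrite ltW.
(* With this constant the entry [i0] of [P ^+ N *m w] is at most half of the lower bound
   [r ^+ N * w i0 0]. *)
have [|N PN] := real_powers_small r0 P_lt (e := w i0 0 / (2 * \sum_i w i 0)).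
  by rewrite divr_gt0 // mulr_gt0.
have rN : 0 < r ^+ N by rewrite exprn_gt0.
have := Pk N i0; rewrite leNgt => /negP; apply; rewrite mxE.
apply: (@le_lt_trans _ _ (\sum_j w i0 0 / (2 * \sum_i w i 0) * r ^+ N * w j 0)).
  apply: ler_sum => j _; rewrite ler_wpM2r ?(ltW (w0 j)) //.
  exact: le_trans (ler_norm _) (PN _ _ _ (leqnn N)).
rewrite -mulr_sumr; set S := \sum_i _ in S0 *.
have -> : w i0 0 / (2 * S) * r ^+ N * S = r ^+ N * (w i0 0 / 2).
  by field; rewrite gt_eqF.
rewrite ltr_pM2l //; have := w0 i0; lra.
Qed.

(** Let [u] hold the moduli of an eigenvector for an eigenvalue of largest modulus [r]. The triangle
    inequality gives [P *m u >= r *: u]. If equality failed, a further application of [P] would make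
    the inequality strict at [w = P *m u], so it would hold with some [r + t > r], which
    [no_super_eigenvector] excludes. *)
Lemma perron_vector m (P : 'M[R]_m) (i0 : 'I_m) : (forall i j, 0 < P i j) ->
  exists (r : R) (u : 'cV[R]_m), [/\ 0 < r, (forall i, 0 < u i 0) & P *m u = r *: u].
Proof.
move=> P0; pose PC := map_mx (real_complex R) P.
have [s Ps] := closed_field_poly_normal (char_poly PC).
rewrite (monicP (char_poly_monic PC)) scale1r in Ps.
have sP mu : (mu \in s) = root (char_poly PC) mu by rewrite Ps root_prod_XsubC.
have size_s : (0 < size s)%N.
  have := size_char_poly PC; rewrite Ps size_prod_XsubC => -[->].
  exact: leq_ltn_trans (ltn_ord i0).
pose k0 := [arg max_(k > Ordinal size_s) normc (tnth (in_tuple s) k)]%O.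
have [nu snu nu_max] : exists2 nu, nu \in s & {in s, forall mu, normc mu <= normc nu}.
  exists (tnth (in_tuple s) k0); first exact: mem_tnth.
  rewrite /k0; case: arg_maxP => //= k _ kmax mu /(tnthP (in_tuple s)) [k' ->].
  exact: kmax.
have /root_char_polyP [z z0 Pz] : root (char_poly PC) nu by rewrite -sP.
pose u : 'cV[R]_m := \col_i normc (z i 0); pose r := normc nu.
have u0 i : 0 <= u i 0 by rewrite mxE normc_ge0.
have u_n0 : u != 0.
  by have /cV0Pn [i zi] := z0; apply/cV0Pn; exists i; rewrite mxE;
     apply: contra_neq zi => /eq0_normc.
have Pu i : r * u i 0 <= (P *m u) i 0.
  have := congr1 (fun v : 'cV__ => normc (v i 0)) Pz; rewrite !mxE normcM /r => <-.
  apply: le_trans (normc_le_sum _) _; apply: ler_sum => k _.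
  by rewrite normcM !mxE normc_real gtr0_norm.
have Pu_gt0 := pos_mulmx_gt0 P0 u0 u_n0.
have eqPu : P *m u = r *: u.
  apply/eqP; rewrite -subr_eq0; apply: contraT => d_n0; exfalso.
  pose w := P *m u.
  have d0 i : 0 <= (P *m u - r *: u) i 0 by have := Pu i; rewrite !mxE; lra.
  have Pd i : r * w i 0 < (P *m w) i 0.
    have := pos_mulmx_gt0 P0 d0 d_n0 i; rewrite mulmxBr -scalemxAr -/w.
    by rewrite [X in 0 < X]mxE [X in _ + X]mxE [X in _ - X]mxE subr_gt0.
  have [|t t0 tle] := @finite_lower_bound _ (fun i => ((P *m w) i 0 - r * w i 0) / w i 0).
    by move=> i; rewrite divr_gt0 // subr_gt0.
  apply: (@no_super_eigenvector _ P (r + t) w i0) => // [i j|||i].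
  - exact: ltW.
  - by rewrite ltr_wpDl // normc_ge0.
  - move=> mu; rewrite /ceigenvalue map_char_poly -sP => /nu_max.
    by move=> /le_lt_trans; apply; rewrite ltrDl.
  - by have := tle i; rewrite ler_pdivlMr // mulrDl; lra.
have ru i : 0 < r * u i 0 by have := Pu_gt0 i; rewrite eqPu mxE.
have r0 : 0 < r by rewrite lt_neqAle normc_ge0 andbT eq_sym;
  apply/eqP => r0; have := ru i0; rewrite r0 mul0r ltxx.
by exists r, u; split => // i; have := ru i; rewrite pmulr_rgt0.
Qed.

(** Subtract from [v] the largest multiple of [u] that keeps the difference nonnegative. The
    difference vanishes at [i1], hence so does its image under [P]; but [P] makes every nonzero
    nonnegative vector positive. *)
Lemma perron_unique m (P : 'M[R]_m) (i0 : 'I_m) (r : R) (u v : 'cV[R]_m) :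
  (forall i j, 0 < P i j) -> (forall i, 0 < u i 0) ->
  P *m u = r *: u -> P *m v = r *: v -> exists c, v = c *: u.
Proof.
move=> P0 u0 Pu Pv.
pose i1 := [arg min_(i < i0) v i 0 / u i 0]%O; exists (v i1 0 / u i1 0).
have i1_min i : v i1 0 / u i1 0 <= v i 0 / u i 0.
  by rewrite /i1; case: arg_minP => //= k _; apply.
set c := _ / _; apply/eqP; rewrite -subr_eq0; apply: contraT => d_n0; exfalso.
have d0 i : 0 <= (v - c *: u) i 0.
  by have := i1_min i; rewrite -/c ler_pdivlMr // !mxE subr_ge0.
have := pos_mulmx_gt0 P0 d0 d_n0 i1.
rewrite mulmxBr Pv -scalemxAr Pu !mxE /c.
suff -> : r * v i1 0 - v i1 0 / u i1 0 * (r * u i1 0) = 0 by rewrite ltxx.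
by field; rewrite gt_eqF.
Qed.

(** For an eigenvector [z], pairing the entrywise inequality [|mu| |z| <= P |z|] with [w] gives
    [|mu| * S <= r * S], where [S > 0]. *)
Lemma left_eigenvector_bound m (P : 'M[R]_m) (r : R) (w : 'cV[R]_m) :
  (forall i j, 0 <= P i j) -> (forall i, 0 < w i 0) -> P^T *m w = r *: w ->
  forall mu, ceigenvalue P mu -> normc mu <= r.
Proof.
move=> P0 w0 Pw mu; rewrite /ceigenvalue map_char_poly => /root_char_polyP [z z0 Pz].
pose S := \sum_i w i 0 * normc (z i 0).
have S0 : 0 < S.
  have /cV0Pn [k zk] := z0; rewrite /S (bigD1 k) //= ltr_pwDl //.
    rewrite mulr_gt0 // lt_neqAle normc_ge0 andbT eq_sym.
    by apply: contra_neq zk => /eq0_normc.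
  by apply: sumr_ge0 => i _; rewrite mulr_ge0 ?normc_ge0 // ltW.
rewrite -(ler_pM2r S0) /S !mulr_sumr.
apply: (@le_trans _ _ (\sum_i w i 0 * \sum_j P i j * normc (z j 0))).
  apply: ler_sum => i _; rewrite mulrCA ler_wpM2l ?(ltW (w0 i)) // -normcM.
  have := congr1 (fun v : 'cV__ => normc (v i 0)) Pz; rewrite !mxE => <-.
  apply: le_trans (normc_le_sum _) _; apply: ler_sum => k _.
  by rewrite normcM !mxE normc_real ger0_norm.
under eq_bigr do rewrite mulr_sumr; rewrite exchange_big /=.
apply: ler_sum => j _; have := congr1 (fun v : 'cV__ => v j 0) Pw; rewrite !mxE.
rewrite mulrA => <-; rewrite mulr_suml le_eqVlt; apply/orP; left; apply/eqP.
by apply: eq_bigr => i _; rewrite mxE mulrCA mulrA.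
Qed.

(* Subtracting a small multiple of the Perron projection keeps the matrix
   positive and only moves the Perron root down, so the remaining eigenvalues
   lie, with multiplicity, in a strictly smaller disc. *)
Lemma perron_spectrum m (P : 'M[R]_m) (I : finType) (nu : I -> R[i]) (i0 : 'I_m) :
  (forall i j, 0 < P i j) ->
  map_poly (real_complex R) (char_poly P) = \prod_a ('X - (nu a)%:P) ->
  exists (r : R) (u w : 'cV[R]_m) (a0 : I),
    [/\ 0 < r, (forall i, 0 < u i 0) /\ P *m u = r *: u,
        (forall i, 0 < w i 0) /\ P^T *m w = r *: w,
        nu a0 = r%:C & forall a, a != a0 -> normc (nu a) < r].
Proof.
move=> P0 Pnu.
have PT0 i j : 0 < P^T i j by rewrite mxE.
have [r [u [r0 u0 Pu]]] := perron_vector i0 P0.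
have [r' [w [r'0 w0 Pw]]] := perron_vector i0 PT0.
have wu0 : 0 < (w^T *m u) 0 0.
  rewrite mxE (bigD1 i0) //= ltr_pwDl ?mulr_gt0 ?mxE //.
  by apply: sumr_ge0 => i _; rewrite mxE mulr_ge0 // ltW.
have wP : w^T *m P = r' *: w^T by have := congr1 trmx Pw; rewrite trmx_mul trmxK linearZ.
(* Both eigenvalues appear on evaluating [w^T *m P *m u] in two ways, and [w^T *m u] is positive. *)
have rr' : r' = r.
  have : w^T *m P *m u = w^T *m (P *m u) by rewrite mulmxA.
  rewrite wP Pu -scalemxAl -scalemxAr => /matrixP /(_ 0 0).
  by rewrite [LHS]mxE [RHS]mxE => /mulIf; apply; rewrite gt_eqF.
rewrite {}rr' in wP Pw.
pose y := ((w^T *m u) 0 0)^-1 *: w^T.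
have y0 i : 0 < y 0 i by rewrite mxE mulr_gt0 ?invr_gt0 //; rewrite mxE.
have yu : (y *m u) 0 0 = 1 by rewrite -scalemxAl mxE mulVf // gt_eqF.
(* [t] is chosen small enough for [P - t *: (u *m y)] to remain entrywise nonnegative. *)
have [|t t0 tle] := @finite_lower_bound ('I_m * 'I_m)%type
    (fun p => P p.1 p.2 / (u p.1 0 * y 0 p.2)).
  by move=> p; rewrite divr_gt0 // mulr_gt0.
pose P' := P - t *: (u *m y).
have P'0 i j : 0 <= P' i j.
  rewrite !mxE big_ord1 subr_ge0.
  by have := tle (i, j); rewrite ler_pdivlMr ?mulr_gt0.
have P'w : P'^T *m w = (r - t) *: w.
  rewrite linearB /= linearZ /= trmx_mul mulmxBl Pw -scalemxAl scalerBl.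
  congr (_ - _ *: _); rewrite [y^T]linearZ /= trmxK -!scalemxAl -mulmxA.
  rewrite [u^T *m w]mx11_scalar mul_mx_scalar scalerA.
  have -> : (u^T *m w) 0 0 = (w^T *m u) 0 0.
    by rewrite !mxE; apply: eq_bigr => k _; rewrite !mxE mulrC.
  by rewrite mulVf ?scale1r // gt_eqF.
have P'_bound := left_eigenvector_bound P'0 w0 P'w.
have := char_poly_deflate t Pu yu => /(congr1 (map_poly (real_complex R))).
rewrite -/P' !rmorphM /= Pnu !map_polyXsubC => defl.
have [a0 nua0] : exists a0, nu a0 = r%:C.
  have : root (\prod_a ('X - (nu a)%:P) * ('X - (r - t)%:C%:P)) r%:C.
    by rewrite -defl rootM root_XsubC eqxx.
  rewrite rootM root_XsubC; case/orP => [|/eqP/complexI]; last by lra.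
  rewrite rootE horner_prod => /prodf_eq0 [a0 _].
  by rewrite -rootE root_XsubC => /eqP; exists a0.
exists r, u, w, a0; split => // a aa0.
(* Cancelling one factor ['X - r] leaves every [nu a] with [a != a0] among the roots for [P'], which
   have modulus at most [r - t]. *)
rewrite (bigD1 a0) //= nua0 -mulrA in defl.
have {}defl := mulfI (monic_neq0 (monicXsubC _)) defl.
apply: (@le_lt_trans _ _ (r - t)); last by lra.
apply: P'_bound; rewrite /ceigenvalue defl rootM (bigD1 a) //= rootM.
by rewrite root_XsubC eqxx.
Qed.

End Perron.

(** * Signature equality *)

Section SignatureEquality.
Variable R : realType.

Lemma sgr_pair (a b : R) : a != 0 -> b != 0 -> Num.sg a = Num.sg b -> (0 < a) = (0 < b).
Proof.
by move=> a0 b0; rewrite -[0 < a]sgr_gt0 -[0 < b]sgr_gt0 => ->.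
Qed.

Lemma mulr_gt0_neq0 (a b : R) : a != 0 -> b != 0 ->
  (0 < a * b) = ((0 < a) == (0 < b)).
Proof.
case: (ltgtP 0 a) => // a0 _ b0; rewrite ?(pmulr_rgt0 _ a0) ?(nmulr_rgt0 _ a0).
  by case: (0 < b).
by case: (ltgtP 0 b) b0.
Qed.

Lemma nozero_same_sign_dot m (x y : 'cV[R]_m) (i0 : 'I_m) :
  nozero_same_sign x y -> 0 < (y^T *m x) 0 0.
Proof.
move=> xy; have pos i : 0 < y^T 0 i * x i 0.
  have [x0 [y0 sg]] := xy i.
  by rewrite mxE -sgr_gt0 sgrM sg -expr2 sqr_sg y0.
by rewrite mxE (bigD1 i0) //= ltr_pwDl // sumr_ge0 // => i _; rewrite ltW.
Qed.

Lemma signature_equality_eventually_SJS m (B : 'M[R]_m) :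
  signature_equality B -> eventually_SJS B.
Proof.
move=> [l [l0 l_simple _ l_dom [x [y [[x0 Bx] [y0 By] xy]]]]].
have /cV0Pn [i0 _] := x0.
have yx := nozero_same_sign_dot i0 xy.
(* This scaling makes [E] a projection onto the line of [x] that commutes with [B]. *)
pose z : 'rV_m := ((y^T *m x) 0 0)^-1 *: y^T.
have zx : (z *m x) 0 0 = 1 by rewrite -scalemxAl mxE mulVf // gt_eqF.
have zB : z *m B = l *: z.
  have := congr1 trmx By; rewrite trmx_mul trmxK linearZ /= => yB.
  by rewrite -scalemxAl yB scalerA mulrC -scalerA.
pose E := x *m z; pose B' := B - l *: E.
have EE : E *m E = E.
  by rewrite /E mulmxA -(mulmxA x) [z *m x]mx11_scalar zx mulmx1.
have BE : B *m E = l *: E by rewrite mulmxA Bx -scalemxAl.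
have EB : E *m B = l *: E by rewrite -mulmxA zB -scalemxAr.
have B'E : B' *m E = 0 by rewrite mulmxBl BE -scalemxAl EE subrr.
have EB' : E *m B' = 0 by rewrite mulmxBr EB -scalemxAr EE subrr.
(* [B'] and [E] annihilate each other, so no cross terms appear. Exponents start at 1, since at 0
   the right side would be [1 + E]. *)
have BX k : B ^+ k.+1 = B' ^+ k.+1 + l ^+ k.+1 *: E.
  elim: k => [|k IH]; first by rewrite !expr1 subrK.
  rewrite exprS IH [B' ^+ k.+2]exprS -[X in X * _ = _](subrK (l *: E)) -/B'.
  rewrite -!mulmxE mulmxDl !mulmxDr -!scalemxAl -!scalemxAr B'E EE scaler0 addr0.
  by rewrite exprS -mulmxE (mulmxA E) EB' mul0mx scaler0 add0r scalerA -!exprS.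
(* Simplicity gives [char_poly B = q * ('X - l%:P)] with [q] nonzero at [l]. Deflation by [t = l]
   turns this into [q * 'X]: the eigenvalues of [B'] are 0 and those of [B] other than [l]. *)
have B'_lt mu : ceigenvalue B' mu -> normc mu < l.
  have B0 : char_poly B != 0 by rewrite monic_neq0 // char_poly_monic.
  have l_root : root (char_poly B) l by apply/root_char_polyP; exists x.
  have /factor_theorem [q Bq] := l_root.
  have q0 : q != 0 by apply: contraNneq B0 => q0; rewrite Bq q0 mul0r.
  have ql : ~~ root q l.
    move: l_simple; rewrite /simple_eigenvalue Bq mupM ?polyXsubC_eq0 //.
    rewrite (@mup_XsubCX _ 1) eqxx addn1 => -[ql].
    by apply/negP; rewrite -dvdp_XsubCl XsubC_dvd // ql.
  have := char_poly_deflate l Bx zx; rewrite Bq subrr subr0 -/E -/B' mulrC -mulrA.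
  rewrite [_ * 'X]mulrC mulrA => /(mulIf (monic_neq0 (monicXsubC _))) B'q.
  rewrite /ceigenvalue B'q rmorphM /= map_polyX rootM rootX orbC.
  case/orP => [/eqP ->|qmu]; first by rewrite normc0.
  rewrite -ltcR; apply: l_dom.
    by rewrite /ceigenvalue Bq rmorphM /= rootM qmu.
  apply: contraNneq ql => mul; move: qmu; rewrite mul.
  by rewrite (fmorph_root (real_complex R)).
have E_sg i j : E i j != 0 /\ (0 < E i j) = ((0 < x i 0) == (0 < x j 0)).
  have [xi [yi sgi]] := xy i; have [xj [yj sgj]] := xy j.
  have -> : E i j = ((y^T *m x) 0 0)^-1 * (x i 0 * y j 0).
    by rewrite mxE big_ord1 [z 0 j]mxE [y^T 0 j]mxE mulrCA.
  rewrite !mulf_neq0 ?invr_eq0 ?(gt_eqF yx) //; split => //.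
  rewrite pmulr_rgt0 ?invr_gt0 // (sgr_pair xj yj sgj).
  exact: mulr_gt0_neq0.
(* With [e] below every [|E i j|], an error of at most [e / 2 * l ^+ k] cannot change the sign of an
   entry of [l ^+ k *: E]. *)
have [|e e0 e_le] := @finite_lower_bound R ('I_m * 'I_m)%type (fun p => `|E p.1 p.2|).
  by move=> p; rewrite normr_gt0; have [] := E_sg p.1 p.2.
have [|N BN] := real_powers_small l0 B'_lt (e := e / 2); first by lra.
exists N.+1 => -[//|k] Nk; exists [set i | 0 < x i 0] => i j.
rewrite !inE BX.
have -> : (B' ^+ k.+1 + l ^+ k.+1 *: E) i j = (B' ^+ k.+1) i j + l ^+ k.+1 * E i j.
  by rewrite mxE [X in _ + X]mxE.
have lk : 0 < l ^+ k.+1 by rewrite exprn_gt0.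
have [Eij Esg] := E_sg i j; have eE := e_le (i, j).
have {}BN := BN k.+1 i j (leq_trans (leqnSn N) Nk).
have {}eE : e * l ^+ k.+1 <= `|l ^+ k.+1 * E i j|.
  by rewrite normrM gtr0_norm // mulrC ler_pM2l.
have el : 0 < e * l ^+ k.+1 by rewrite mulr_gt0.
have Dsg : (0 < l ^+ k.+1 * E i j) = (0 < E i j) by rewrite pmulr_rgt0.
move: BN; rewrite ler_norml => /andP [].
rewrite -Esg -Dsg; case: (ltP 0 (l ^+ k.+1 * E i j)) => D0; move: eE.
  by rewrite gtr0_norm //; lra.
by rewrite ler0_norm //; lra.
Qed.

End SignatureEquality.

(** * Index sets and the Cauchy-Binet formula *)

Section IndexSets.
Variables n j : nat.
Implicit Types (t : j.-tuple 'I_n) (a b : 'I_(nsets n j)).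

Lemma lexle_total : total lexle.
Proof.
elim=> [|x s IH] [|y t] //=; case: (ltngtP x y) => //= _; exact: IH.
Qed.

Lemma lexle_trans : transitive lexle.
Proof.
move=> t s u; elim: s t u => [|x s IH] [|y t] [|z u] //=.
case: (ltngtP x y) => //= xy; case: (ltngtP y z) => //= yz; subst.
- by move=> _ _; rewrite (ltn_trans xy yz).
- by rewrite xy.
- by rewrite yz.
by rewrite ltnn eqxx /=; apply: IH.
Qed.

Lemma lexle_neq (s t : seq nat) : size s = size t -> lexle s t -> s != t ->
  exists2 r, (r < size s)%N & (nth 0 s r < nth 0 t r)%N.
Proof.
elim: s t => [|x s IH] [|y t] //= [st]; case: (ltngtP x y) => //= [xy _ _|-> le_st].
  by exists 0%N.
rewrite eqseq_cons eqxx /= => /(IH _ st le_st) [r rs lt_r].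
by exists r.+1.
Qed.

Lemma mem_index_sets t :
  (t \in index_sets n j) = sorted ltn (map (@nat_of_ord n) t).
Proof. by rewrite mem_sort mem_filter mem_enum andbT. Qed.

Lemma index_sets_uniq : uniq (index_sets n j).
Proof. by rewrite sort_uniq filter_uniq // enum_uniq. Qed.

Lemma iset_nth t a : iset a = nth t (index_sets n j) a.
Proof. by rewrite /iset (tnth_nth t). Qed.

Lemma iset_inj : injective (@iset n j).
Proof.
move=> a b eq_ab; apply: val_inj; apply/eqP.
by rewrite -(nth_uniq (iset a) (ltn_ord a) (ltn_ord b) index_sets_uniq) -!iset_nth eq_ab.
Qed.

Lemma iset_sorted a : sorted ltn (map (@nat_of_ord n) (iset a)).
Proof. by rewrite -mem_index_sets mem_tnth. Qed.

Lemma iset_onto t : sorted ltn (map (@nat_of_ord n) t) -> exists a, iset a = t.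
Proof.
rewrite -mem_index_sets => /(tnthP (in_tuple (index_sets n j))) [a ->].
by exists a.
Qed.

Lemma iset_mono a (r s : 'I_j) :
  (r < s)%N -> (tnth (iset a) r < tnth (iset a) s)%N.
Proof.
move=> rs; have x0 := tnth (iset a) r.
have := sorted_ltn_nth ltn_trans 0%N (iset_sorted a).
move=> /(_ r s); rewrite !inE !size_map !size_tuple !ltn_ord => /(_ isT isT rs).
by rewrite !(nth_map x0) ?size_tuple // !(tnth_nth x0).
Qed.

Lemma iset_leq a (r s : 'I_j) :
  (r <= s)%N -> (tnth (iset a) r <= tnth (iset a) s)%N.
Proof.
rewrite leq_eqVlt => /orP [/eqP/val_inj -> //|/(iset_mono a)]; exact: ltnW.
Qed.

Lemma tnth_iset_inj a : injective (tnth (iset a)).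
Proof.
move=> r s eq_rs; apply: val_inj.
by case: (ltngtP r s) => //= /(iset_mono a); rewrite eq_rs ltnn.
Qed.

Lemma iset_mem_inj a b : iset a =i iset b -> a = b.
Proof.
move=> eq_ab; apply/iset_inj/val_inj/(inj_map val_inj).
apply: (irr_sorted_eq ltn_trans ltnn (iset_sorted a) (iset_sorted b)).
move=> x; apply/mapP/mapP => -[y yab ->]; exists y => //; first by rewrite -eq_ab.
by rewrite eq_ab.
Qed.

(** At the first place where two index sets differ, the lexicographically earlier one has the
    smaller entry. This makes compounds of triangular matrices triangular. *)
Lemma iset_ltn_ex a b : (a < b)%N ->
  exists r, (tnth (iset a) r < tnth (iset b) r)%N.
Proof.
move=> ab; pose le_lex (s t : j.-tuple 'I_n) :=
  lexle (map (@nat_of_ord n) s) (map (@nat_of_ord n) t).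
have srt : sorted le_lex (index_sets n j).
  by apply: sort_sorted => s t; apply: lexle_total.
have lex_trans : transitive le_lex by move=> s t u; apply: lexle_trans.
have := sorted_ltn_nth lex_trans (iset a) srt.
move=> /(_ a b (ltn_ord a) (ltn_ord b) ab); rewrite -!iset_nth => le_ab.
have [||r] := lexle_neq _ le_ab; first by rewrite !size_map !size_tuple.
  apply: contraTneq ab => /(inj_map val_inj) /val_inj /iset_inj ->.
  by rewrite ltnn.
rewrite size_map size_tuple => rj; pose r' := Ordinal rj; have x0 := tnth (iset a) r'.
rewrite !(nth_map x0) ?size_tuple // => lt_r; exists r'.
by rewrite !(tnth_nth x0).
Qed.

Lemma iset_codom (f : 'I_j -> 'I_n) : injective f ->
  exists a, forall x, (x \in iset a) = (x \in codom f).
Proof.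
move=> f_inj; pose le_ord (x y : 'I_n) := (x <= y)%N.
have sz : size (sort le_ord (codom f)) == j by rewrite size_sort size_codom card_ord.
have [|a a_eq] := @iset_onto (Tuple sz).
  rewrite ltn_sorted_uniq_leq map_inj_uniq ?sort_uniq; last exact: val_inj.
  have -> : uniq (codom f) by apply/injectiveP.
  rewrite sorted_map.
  by apply: sort_sorted => x y; apply: leq_total.
by exists a => x; rewrite a_eq mem_sort.
Qed.

End IndexSets.

(** * The Cauchy-Binet formula, multiplicativity of compounds and their action on wedge products *)

Section CauchyBinet.
Variable A : comNzRingType.

(** Each injection of ['I_j] into ['I_n] is, in exactly one way, a permutation followed by the
    increasing enumeration of its image. *)
Definition perm_iset n j (p : 'I_(nsets n j) * 'S_j) : {ffun 'I_j -> 'I_n} :=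
  [ffun r => tnth (iset p.1) (p.2 r)].

Lemma perm_iset_inj n j : injective (@perm_iset n j).
Proof.
move=> [a s] [b t] /ffunP eq_ab; have {}eq_ab r : tnth (iset a) (s r) = tnth (iset b) (t r).
  by have := eq_ab r; rewrite !ffunE.
have ab : a = b.
  apply: iset_mem_inj => x; apply/tnthP/tnthP => -[r ->].
    by exists (t (s^-1%g r)); rewrite -eq_ab permKV.
  by exists (s (t^-1%g r)); rewrite eq_ab permKV.
subst b; congr (_, _).
by apply/permP => r; apply: (@tnth_iset_inj n j a).
Qed.

Lemma perm_iset_onto n j (f : {ffun 'I_j -> 'I_n}) :
  injectiveb f = (f \in [set perm_iset p | p in setT]).
Proof.
apply/injectiveP/imsetP => [f_inj|[[a s] _ ->] r t].
  have [a a_mem] := iset_codom f_inj.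
  have f_a r : exists s, f r = tnth (iset a) s.
    by apply/tnthP; rewrite a_mem codom_f.
  have [s fs] := fin_all_exists f_a.
  have s_inj : injective s by move=> r t eq_rt; apply: f_inj; rewrite !fs eq_rt.
  by exists (a, perm s_inj) => //; apply/ffunP => r; rewrite ffunE /= permE.
by rewrite !ffunE => /tnth_iset_inj /perm_inj.
Qed.

Lemma det_rowsub_perm n j (B : 'M[A]_(n, j)) (p : 'I_(nsets n j) * 'S_j) :
  \det (rowsub (perm_iset p) B) = (-1) ^+ p.2 * \det (rowsub (tnth (iset p.1)) B).
Proof.
rewrite -det_perm -det_mulmx -row_permE; congr (\det _).
by apply/matrixP => r s; rewrite !mxE ffunE.
Qed.

(** Multilinear expansion gives a sum over all maps [f] from ['I_j] to ['I_n]. Non-injective maps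
    contribute determinants with two equal rows; injective ones are grouped by image, and the
    permutations of each image rebuild the determinant of the left factor. *)
Lemma cauchy_binet n j (M : 'M[A]_(j, n)) (N : 'M[A]_(n, j)) :
  \det (M *m N) = \sum_(a < nsets n j)
    \det (colsub (tnth (iset a)) M) * \det (rowsub (tnth (iset a)) N).
Proof.
pose G (f : {ffun 'I_j -> 'I_n}) := (\prod_r M r (f r)) * \det (rowsub f N).
transitivity (\sum_f G f).
  rewrite /determinant; transitivity (\sum_(s : 'S_j) \sum_(f : {ffun 'I_j -> 'I_n})
      (-1) ^+ s * \prod_r (M r (f r) * N (f r) (s r))).
    apply: eq_bigr => s _; rewrite -mulr_sumr.
    rewrite -(bigA_distr_bigA (fun r k => M r k * N k (s r))).
    by congr (_ * _); apply: eq_bigr => r _; rewrite mxE.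
  rewrite exchange_big; apply: eq_bigr => f _; rewrite /G /determinant mulr_sumr.
  apply: eq_bigr => s _; rewrite big_split /= mulrCA; congr (_ * (_ * _)).
  by apply: eq_bigr => r _; rewrite mxE.
rewrite (bigID [pred f : {ffun 'I_j -> 'I_n} | injectiveb f]) /= [X in _ + X]big1 ?addr0.
  rewrite (eq_bigl _ _ (@perm_iset_onto n j)) big_imset /=; last first.
    by move=> p q _ _; apply: perm_iset_inj.
  rewrite (eq_bigl xpredT) => [|p]; last by rewrite inE.
  rewrite -(pair_bigA _ (fun a s => G (perm_iset (a, s)))) /=.
  apply: eq_bigr => a _; rewrite /determinant mulr_suml; apply: eq_bigr => s _.
  rewrite /G det_rowsub_perm /= -/(determinant _) mulrCA mulrA; congr (_ * _ * _).
  by apply: eq_bigr => r _; rewrite mxE ffunE.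
move=> f /injectivePn [r [s rs frs]].
rewrite /G (determinant_alternate rs) ?mulr0 // => k.
by rewrite !mxE frs.
Qed.

Lemma compoundE n (M : 'M[A]_n) j a b :
  compound M j a b = \det (mxsub (tnth (iset a)) (tnth (iset b)) M).
Proof. by rewrite mxE. Qed.

Lemma compound_mul n (M N : 'M[A]_n) j :
  compound (M *m N) j = compound M j *m compound N j.
Proof.
apply/matrixP => a b; rewrite compoundE mxE.
have -> : mxsub (tnth (iset a)) (tnth (iset b)) (M *m N)
        = rowsub (tnth (iset a)) M *m colsub (tnth (iset b)) N.
  by apply/matrixP => r s; rewrite !mxE; apply: eq_bigr => k _; rewrite !mxE.
rewrite cauchy_binet; apply: eq_bigr => c _; rewrite !compoundE.
by congr (_ * _); congr (\det _); apply/matrixP => r s; rewrite !mxE.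
Qed.

Lemma compound_trmx n (M : 'M[A]_n) j : compound M^T j = (compound M j)^T.
Proof.
apply/matrixP => a b; rewrite compoundE [RHS]mxE compoundE -det_tr; congr (\det _).
by apply/matrixP => r s; rewrite !mxE.
Qed.

(* A permutation cannot map [{0..r}] into [{0..r-1}], so each term of the Leibniz
   formula meets the vanishing block. *)
Lemma det_zero_block j (M : 'M[A]_j) (r : 'I_j) :
  (forall i k : 'I_j, (i <= r)%N -> (r <= k)%N -> M i k = 0) -> \det M = 0.
Proof.
move=> M0; apply: big1 => s _.
have [i ir si] : exists2 i : 'I_j, (i <= r)%N & (r <= s i)%N.
  apply/exists_inP; rewrite -[X in is_true X]negbK negb_exists_in; apply/negP.
  move=> /forall_inP small; pose X := [set i : 'I_j | (i < r)%N].
  have sub : [set s i | i in r |: X] \subset X.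
    apply/subsetP => _ /imsetP [k kX ->].
    by rewrite inE ltnNge small // leq_eqVlt; move: kX; rewrite !inE -val_eqE.
  have := subset_leq_card sub; rewrite card_imset; last exact: perm_inj.
  by rewrite cardsU1 inE ltnn /= add1n ltnn.
by rewrite (bigD1 i) //= M0 // mul0r mulr0.
Qed.

Lemma compound_trig n (T : 'M[A]_n) j :
  is_trig_mx T -> is_trig_mx (compound T j).
Proof.
move=> /is_trig_mxP T0; apply/is_trig_mxP => a b /iset_ltn_ex [r ab].
rewrite compoundE; apply: (det_zero_block (r := r)) => i k ir rk; rewrite mxE T0 //.
exact: leq_ltn_trans (iset_leq a ir) (leq_trans ab (iset_leq b rk)).
Qed.

Lemma compound_trig_diag n (T : 'M[A]_n) j a : is_trig_mx T ->
  compound T j a a = \prod_r T (tnth (iset a) r) (tnth (iset a) r).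
Proof.
move=> /is_trig_mxP T0; rewrite compoundE det_trig.
  by apply: eq_bigr => r _; rewrite mxE.
by apply/is_trig_mxP => r s rs; rewrite mxE T0 // iset_mono.
Qed.

Lemma compound1 n j : compound (1%:M : 'M[A]_n) j = 1%:M.
Proof.
have trig1 : is_trig_mx (1%:M : 'M[A]_n) by rewrite scalar_mx_is_trig.
have /is_trig_mxP low := compound_trig j trig1.
apply/matrixP => a b; rewrite [RHS]mxE -val_eqE; case: (ltngtP a b) => /= ab.
- exact: low.
- by rewrite -(trmx1 _ n) compound_trmx mxE low.
- rewrite (val_inj ab) compound_trig_diag // big1 // => r _.
  by rewrite mxE eqxx.
Qed.

Lemma compoundX n (M : 'M[A]_n) j k : compound (M ^+ k) j = compound M j ^+ k.
Proof.
elim: k => [|k IH]; first exact: compound1.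
by rewrite !exprS compound_mul IH.
Qed.

Lemma wedgeE n j (x : 'I_j -> 'cV[A]_n) a :
  wedge x a 0 = \det (rowsub (tnth (iset a)) (\matrix_(i, s) x s i 0)).
Proof. by rewrite mxE; congr (\det _); apply/matrixP => r s; rewrite !mxE. Qed.

Lemma wedge_mul n j (M : 'M[A]_n) (x : 'I_j -> 'cV[A]_n) :
  compound M j *m wedge x = wedge (fun s => M *m x s).
Proof.
apply/colP => a; rewrite wedgeE mxE.
have -> : \matrix_(i, s) (M *m x s) i 0 = M *m (\matrix_(i, s) x s i 0).
  by apply/matrixP => i s; rewrite !mxE; apply: eq_bigr => k _; rewrite !mxE.
rewrite -mul_rowsub_mx cauchy_binet; apply: eq_bigr => b _.
rewrite compoundE wedgeE; congr (_ * _); congr (\det _).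
by apply/matrixP => r s; rewrite !mxE.
Qed.

Lemma wedge_scale n j (c : 'I_j -> A) (x : 'I_j -> 'cV[A]_n) :
  wedge (fun s => c s *: x s) = (\prod_s c s) *: wedge x.
Proof.
apply/colP => a; rewrite mxE [RHS]mxE [X in _ = _ * X]mxE.
have -> : \prod_s c s = \det (diag_mx (\row_s c s)).
  by rewrite det_diag; apply: eq_bigr => s _; rewrite mxE.
rewrite mulrC -det_mulmx; congr (\det _).
by apply/matrixP => r s; rewrite mul_mx_diag !mxE mulrC.
Qed.

End CauchyBinet.

(** * The spectrum of a compound matrix *)

Section CompoundSpectrum.

Lemma char_poly_conj (F : fieldType) m (S A B : 'M[F]_m) :
  S \in unitmx -> S *m A = B *m S -> char_poly A = char_poly B.
Proof.
move=> Su SA; have eq_mx : map_mx polyC S *m char_poly_mx A = char_poly_mx B *m map_mx polyC S.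
  by rewrite mulmxBr mulmxBl mul_mx_scalar mul_scalar_mx -!map_mxM SA.
have := congr1 determinant eq_mx; rewrite !det_mulmx mulrC; apply: mulIf.
by rewrite det_map_mx polyC_eq0 -unitfE -unitmxE.
Qed.

Lemma mul_trig_mx (A : comNzRingType) n (T U : 'M[A]_n) :
  is_trig_mx T -> is_trig_mx U ->
  is_trig_mx (T *m U) /\ forall i, (T *m U) i i = T i i * U i i.
Proof.
move=> /is_trig_mxP T0 /is_trig_mxP U0; split=> [|i].
  apply/is_trig_mxP => i k ik; rewrite mxE big1 // => l _.
  by case: (ltnP i l) => [/T0 ->|li]; rewrite ?mul0r // U0 ?mulr0 // (leq_ltn_trans li).
rewrite mxE (bigD1 i) //= big1 ?addr0 // => l li.
case: (ltngtP i l) => [/T0 ->|/U0 ->|/val_inj il]; rewrite ?mul0r ?mulr0 //.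
by rewrite il eqxx in li.
Qed.

Lemma trig_mxX (A : comNzRingType) n (T : 'M[A]_n) k : is_trig_mx T ->
  is_trig_mx (T ^+ k) /\ forall i, (T ^+ k) i i = T i i ^+ k.
Proof.
move=> Tt; elim: k => [|k [IHt IHd]].
  by rewrite expr0 scalar_mx_is_trig; split=> // i; rewrite mxE eqxx.
rewrite exprS; have [TTt TTd] := mul_trig_mx Tt IHt; split => // i.
by rewrite TTd IHd exprS.
Qed.

Lemma schur_conj (C : numClosedFieldType) n (A : 'M[C]_n) :
  exists S T : 'M[C]_n, [/\ S \in unitmx, is_trig_mx T & S *m A = T *m S].
Proof.
case: n A => [|n] A.
  by exists 1%:M, A; split; rewrite ?unitmx1 ?mul1mx ?mulmx1 //; apply/is_trig_mxP => -[].
have [|S Su tT] := @Schur C n.+1 A; first by [].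
have {}Su := unitarymx_unit Su.
exists S, (conjmx S A); split => //.
by rewrite conjumx // mulmxKV.
Qed.

Lemma prod_iset (A : comNzRingType) n j (d : 'I_n -> A) (a : 'I_(nsets n j)) :
  \prod_r d (tnth (iset a) r) = \prod_(i in [set x in iset a]) d i.
Proof.
rewrite -(big_tuple _ _ (iset a) xpredT d) big_uniq /=.
  by apply: eq_bigl => i; rewrite inE.
have := iset_sorted a; rewrite ltn_sorted_uniq_leq => /andP [+ _].
exact: map_uniq.
Qed.

Lemma big_iset (A : comNzRingType) n j (G : {set 'I_n} -> A) :
  \prod_(a < nsets n j) G [set x in iset a] = \prod_(S : {set 'I_n} | #|S| == j) G S.
Proof.
pose h (a : 'I_(nsets n j)) := [set x in iset a].
have h_inj : injective h.
  by move=> a b /setP ab; apply: iset_mem_inj => x; have := ab x; rewrite !inE.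
transitivity (\prod_(S in [set h a | a in setT]) G S).
  rewrite big_imset /=; last by move=> a b _ _; apply: h_inj.
  by apply: eq_bigl => a; rewrite inE.
apply: eq_bigl => S; apply/imsetP/eqP => [[a _ ->]|Sj].
  rewrite -(card_ord j) -(card_imset _ (@tnth_iset_inj n j a)); apply: eq_card => x.
  by rewrite inE; apply/tnthP/imsetP => [[r ->]|[r _ ->]]; exists r.
have f_inj : injective (fun r : 'I_j => enum_val (cast_ord (esym Sj) r)).
  by move=> r t /enum_val_inj /cast_ord_inj.
have [a a_mem] := iset_codom f_inj; exists a => //; apply/setP => x; rewrite inE a_mem.
apply/idP/codomP => [xS|[r ->]]; last exact: enum_valP.
by exists (cast_ord Sj (enum_rank_in xS x)); rewrite cast_ordK enum_rankK_in.
Qed.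

(** A permutation of ['I_n] need not send increasing tuples to increasing tuples, so the product is
    rewritten over [j]-element subsets, which it permutes. This allows the eigenvalues to be listed
    in any order. *)
Lemma big_iset_perm (A : comNzRingType) n j (s : 'S_n) (d : 'I_n -> A) (G : A -> {poly A}) :
  \prod_(a < nsets n j) G (\prod_r d (s (tnth (iset a) r)))
  = \prod_(a < nsets n j) G (\prod_r d (tnth (iset a) r)).
Proof.
under eq_bigr => a _ do rewrite (prod_iset (fun i => d (s i))).
under [RHS]eq_bigr => a _ do rewrite prod_iset.
rewrite (big_iset j (fun S => G (\prod_(i in S) d (s i)))).
rewrite (big_iset j (fun S => G (\prod_(i in S) d i))).
have s_inj : injective (fun S : {set 'I_n} => s @: S) by apply: imset_inj; apply: perm_inj.
rewrite [RHS](reindex_inj s_inj) /=; apply: eq_big => S.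
  by rewrite card_imset //; apply: perm_inj.
by move=> _; rewrite big_imset //= => i k _ _; apply: perm_inj.
Qed.

(** A single list [d], ordered by decreasing modulus, serves all [j] and [k], so that the spectra of
    different compounds and powers can be compared. *)
Lemma compound_spectrum (R : realType) n (A : 'M[R[i]]_n) :
  exists d : 'I_n -> R[i],
    [/\ char_poly A = \prod_i ('X - (d i)%:P),
        (forall i k : 'I_n, (i <= k)%N -> normc (d k) <= normc (d i)) &
        forall j k, char_poly (compound (A ^+ k) j)
          = \prod_(a < nsets n j) ('X - ((\prod_r d (tnth (iset a) r)) ^+ k)%:P)].
Proof.
have [S [T [Su Tt SA]]] := schur_conj A.
pose ge_norm (x y : R[i]) := normc y <= normc x.
pose t := [tuple T i i | i < n].
(* [s] sorts the diagonal of the Schur form by modulus. *)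
have /tuple_permP [s ts] : perm_eq (sort_tuple ge_norm t) t by rewrite perm_sort.
pose d i := T (s i) (s i).
have d_tnth i : d i = tnth (sort_tuple ge_norm t) i.
  by rewrite (tnth_nth 0) /= ts nth_mktuple tnth_mktuple.
exists d; split.
- rewrite (char_poly_conj Su SA) char_poly_trig //.
  exact: (reindex_inj (@perm_inj _ s)).
- move=> i k ik; rewrite !d_tnth !(tnth_nth 0) /=.
  have ge_trans : transitive ge_norm by move=> x y z; rewrite /ge_norm => xy /le_trans; apply.
  have ge_refl : reflexive ge_norm by move=> x; rewrite /ge_norm.
  have ge_total : total ge_norm by move=> x y; rewrite /ge_norm le_total.
  by apply: (sorted_leq_nth ge_trans ge_refl 0 (sort_sorted ge_total t)) => //;
     rewrite inE size_sort size_tuple.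
- move=> j k; rewrite (big_iset_perm j s (fun i => T i i) (fun z => 'X - (z ^+ k)%:P)).
  have CSu : compound S j \in unitmx.
    have : compound S j *m compound (invmx S) j = 1%:M by rewrite -compound_mul mulmxV // compound1.
    by case/mulmx1_unit.
  have CSA : compound S j *m compound (A ^+ k) j = compound (T ^+ k) j *m compound S j.
    rewrite -!compound_mul; congr (compound _ j).
    elim: k => [|k IH]; first by rewrite mulmx1 mul1mx.
    by rewrite !exprSr -!mulmxE mulmxA IH -mulmxA SA mulmxA.
  have [Tkt Tkd] := trig_mxX k Tt.
  rewrite (char_poly_conj CSu CSA) char_poly_trig ?compound_trig //.
  apply: eq_bigr => a _; rewrite compound_trig_diag //; congr ('X - _%:P).
  by rewrite -prodrXl; apply: eq_bigr => r _; rewrite Tkd.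
Qed.

End CompoundSpectrum.

(** * Initial index sets, eigenvectors of compounds and independence of eigenvectors *)

Lemma iset_of_mono n j (f : 'I_j -> 'I_n) :
  (forall r s : 'I_j, (r < s)%N -> (f r < f s)%N) ->
  exists a, forall r, tnth (iset a) r = f r.
Proof.
move=> f_mono; have [|a a_eq] := @iset_onto n j [tuple f r | r < j].
  rewrite /= -map_comp; apply: (homo_sorted (e := relpre val ltn)) => //.
  by rewrite -sorted_map val_enum_ord iota_ltn_sorted.
by exists a => r; rewrite a_eq tnth_mktuple.
Qed.

Lemma leq_iset n j (a : 'I_(nsets n j)) (r : 'I_j) : (r <= tnth (iset a) r)%N.
Proof.
case: r => r; elim: r => [|r IH] rj //=.
have := IH (ltnW rj); rewrite /= => /leq_ltn_trans; apply.
exact: iset_mono.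
Qed.

Lemma iset_first n j (hj : (j <= n)%N) :
  exists a, forall r, tnth (iset a) r = widen_ord hj r.
Proof. exact: iset_of_mono. Qed.

Lemma iset_not_first n j (hj : (j <= n)%N) (a0 a : 'I_(nsets n j)) :
  (forall r, tnth (iset a0) r = widen_ord hj r) -> a != a0 ->
  exists r : 'I_j, (r < tnth (iset a) r)%N.
Proof.
move=> a0E aa0; apply/existsP; apply: contraNT aa0.
rewrite negb_exists => /forallP small; apply/eqP/iset_inj/eq_from_tnth => r.
apply: val_inj; rewrite /= a0E /=; apply/eqP; rewrite eqn_leq leq_iset andbT leqNgt.
exact: small.
Qed.

Lemma wedge_eigen (A : comNzRingType) n j (M : 'M[A]_n) (c : 'I_j -> A)
    (x : 'I_j -> 'cV[A]_n) : (forall s, M *m x s = c s *: x s) ->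
  compound M j *m wedge x = (\prod_s c s) *: wedge x.
Proof.
move=> Mx; rewrite wedge_mul -wedge_scale; apply/colP => a; rewrite !wedgeE.
congr (\det (rowsub _ _)); apply/matrixP => i s.
by rewrite mxE [RHS]mxE Mx.
Qed.

Lemma mulmx_eigenX (A : comNzRingType) n (M : 'M[A]_n) (c : A) (x : 'cV[A]_n) k :
  M *m x = c *: x -> M ^+ k *m x = c ^+ k *: x.
Proof.
move=> Mx; elim: k => [|k IH]; first by rewrite mul1mx scale1r.
by rewrite exprS -mulmxE -mulmxA IH -scalemxAr Mx scalerA -exprSr.
Qed.

Lemma map_compound (A B : comNzRingType) (f : {rmorphism A -> B}) n (M : 'M[A]_n) j :
  map_mx f (compound M j) = compound (map_mx f M) j.
Proof.
apply/matrixP => a b; rewrite mxE !compoundE -det_map_mx; congr (\det _).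
by apply/matrixP => r s; rewrite !mxE.
Qed.

Lemma mup_prod_XsubC (F : fieldType) (I : finType) (d : I -> F) (a0 : I) :
  (forall a, a != a0 -> d a != d a0) -> mup (d a0) (\prod_a ('X - (d a)%:P)) = 1%N.
Proof.
move=> d_neq; rewrite (bigD1 a0) //= mupMl.
  by rewrite (@mup_XsubCX _ 1) eqxx.
rewrite rootE horner_prod; apply/prodf_neq0 => a aa0.
by rewrite -rootE root_XsubC eq_sym d_neq.
Qed.

(** Induction on the size of the support of a relation [X *m v = 0]: applying [A - l i] kills
    coordinate [i] and multiplies every other coordinate by the nonzero [l k - l i]. *)
Lemma eigenvectors_unitmx (F : fieldType) n (A X : 'M[F]_n) (l : 'I_n -> F) :
  injective l -> (forall i, col i X != 0) ->
  (forall i, A *m col i X = l i *: col i X) -> X \in unitmx.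
Proof.
move=> l_inj X0 AX.
have free N (v : 'cV[F]_n) : (#|[pred i | v i 0%R != 0%R]| <= N)%N -> X *m v = 0 -> v = 0.
  elim: N v => [|N IH] v supp Xv.
    apply/colP => i; rewrite mxE; apply/eqP.
    by move: supp; rewrite leqn0 => /eqP/card0_eq/(_ i); rewrite inE => /negbFE.
  apply/eqP; apply: contraT => /cV0Pn [i vi].
  pose v' : 'cV_n := \col_k ((l k - l i) * v k 0).
  have Xsum w : X *m w = \sum_k w k 0 *: col k X.
    by apply/colP => k; rewrite mxE summxE; apply: eq_bigr => h _; rewrite !mxE mulrC.
  have Xv' : X *m v' = 0.
    transitivity (A *m (X *m v) - l i *: (X *m v)); last by rewrite Xv mulmx0 scaler0 subr0.
    rewrite !Xsum mulmx_sumr scaler_sumr -sumrB; apply: eq_bigr => k _.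
    by rewrite mxE -scalemxAr AX !scalerA -scalerBl mulrBl [l k * _]mulrC.
  have v'0 : v' = 0.
    apply: IH Xv'; rewrite -ltnS; apply: leq_trans supp.
    apply: proper_card; apply/properP; split; last by exists i; rewrite !inE ?vi // mxE subrr mul0r eqxx.
    by apply/subsetP => k; rewrite !inE mxE mulf_eq0 negb_or => /andP [].
  have vk k : k != i -> v k 0 = 0.
    move=> ki; have := congr1 (fun w : 'cV__ => w k 0) v'0; rewrite !mxE => /eqP.
    by rewrite mulf_eq0 subr_eq0 (inj_eq l_inj) (negPf ki) => /eqP.
  move: Xv; rewrite Xsum (bigD1 i) //= big1 ?addr0; last by move=> k /vk ->; rewrite scale0r.
  by move=> /eqP; rewrite scaler_eq0 (negPf vi) (negPf (X0 i)).
rewrite -unitmx_tr unitmxE unitfE; apply/negP => /det0P [v v0 vX].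
have : v^T = 0.
  by apply: (free n); [rewrite -[n in (_ <= n)%N]card_ord max_card | rewrite -[X]trmxK -trmx_mul vX trmx0].
by move/eqP; rewrite trmx_eq0 (negPf v0).
Qed.

(** * From total signature equality to the compounds, and from the compounds to eventual strict
    total sign-symmetry *)

Section Implications.
Variable R : realType.

(** The complex list [d] and the real list [l] split the same polynomial, so they agree up to a
    permutation, which the product over index sets does not see. *)
Lemma compound_charpoly n (A : 'M[R]_n) (l : 'I_n -> R) j :
  char_poly A = \prod_i ('X - (l i)%:P) ->
  char_poly (compound A j) = \prod_(a < nsets n j) ('X - (\prod_r l (tnth (iset a) r))%:P).
Proof.
move=> Al; pose toC := real_complex R.
have [d [Ad _ Cd]] := compound_spectrum (map_mx toC A).
have : \prod_(z <- [tuple d i | i < n]) ('X - z%:P)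
     = \prod_(z <- [tuple toC (l i) | i < n]) ('X - z%:P).
  rewrite !big_tuple; transitivity (char_poly (map_mx toC A)).
    by rewrite Ad; apply: eq_bigr => i _; rewrite tnth_mktuple.
  rewrite -map_char_poly Al rmorph_prod; apply: eq_bigr => i _.
  by rewrite tnth_mktuple /= map_polyXsubC.
move=> /prod_XsubC_eq /tuple_permP [s ds].
have dE i : d i = toC (l (s i)).
  have := congr1 (fun t => nth 0 t i) ds.
  by rewrite /= !nth_mktuple tnth_mktuple.
apply: (map_poly_inj toC); rewrite map_char_poly map_compound -[map_mx _ A]expr1 Cd.
rewrite rmorph_prod /=.
transitivity (\prod_(a < nsets n j)
    ('X - ((\prod_r toC (l (s (tnth (iset a) r)))) ^+ 1)%:P)).
  by apply: eq_bigr => a _; congr ('X - (_ ^+ 1)%:P); apply: eq_bigr => r _.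
rewrite (big_iset_perm j s (fun i => toC (l i)) (fun z => 'X - (z ^+ 1)%:P)).
by apply: eq_bigr => a _; rewrite map_polyXsubC expr1 (rmorph_prod (real_complex R)).
Qed.

Lemma decreasing_inj n (l : 'I_n -> R) :
  (forall i k : 'I_n, (i < k)%N -> l k < l i) -> injective l.
Proof.
move=> l_dec i k lik; apply: val_inj; case: (ltngtP i k) => // ik.
  by have := l_dec _ _ ik; rewrite lik ltxx.
by have := l_dec _ _ ik; rewrite lik ltxx.
Qed.

(** Factorwise comparison: entry [r] of any index set is at least [r], with strict inequality
    somewhere unless the set is the initial one. *)
Lemma ltr_prod_iset n j (hj : (j <= n)%N) (l : 'I_n -> R) (a0 a : 'I_(nsets n j)) :
  (forall i, 0 < l i) -> (forall i k : 'I_n, (i < k)%N -> l k < l i) ->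
  (forall r, tnth (iset a0) r = widen_ord hj r) -> a != a0 ->
  \prod_r l (tnth (iset a) r) < \prod_r l (tnth (iset a0) r).
Proof.
move=> l0 l_dec a0E aa0; have [r ra] := iset_not_first a0E aa0.
rewrite (bigD1 r) //= [ltRHS](bigD1 r) //=.
apply: (@le_lt_trans _ _ (l (tnth (iset a) r) * \prod_(i | i != r) l (tnth (iset a0) i))).
  rewrite ler_pM2l //; apply: ler_prod => s _; rewrite ltW //= a0E.
  have := leq_iset a s; rewrite leq_eqVlt => /orP [/eqP sa|sa]; last first.
    by apply/ltW/l_dec.
  by rewrite le_eqVlt (_ : tnth (iset a) s = widen_ord hj s) ?eqxx //; apply: val_inj.
rewrite ltr_pM2r; last by apply: prodr_gt0.
by apply: l_dec; rewrite a0E.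
Qed.

Lemma total_signature_equality_compound n (A : 'M[R]_n) :
  total_signature_equality A ->
  forall j, (0 < j <= n)%N -> signature_equality (compound A j).
Proof.
move=> [l [x [xs [l0 l_dec l_simple eigen signs]]]] j /andP [j0 hj].
have l_inj := decreasing_inj l_dec.
(* The [n] distinct eigenvalues exhaust the roots of a monic polynomial of degree [n]. *)
have Al : char_poly A = \prod_i ('X - (l i)%:P).
  have := @all_roots_prod_XsubC _ (char_poly A) (codom l).
  rewrite size_char_poly size_codom card_ord (monicP (char_poly_monic A)) scale1r.
  rewrite /codom big_image => -> //; last first.
    by rewrite uniq_rootsE; apply/injectiveP.
  apply/allP => _ /codomP [i ->]; apply/root_char_polyP.
  by have [[xi0 Axi] _] := eigen i; exists (x i).
have CA := compound_charpoly j Al.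
have [a0 a0E] := iset_first hj.
pose L (a : 'I_(nsets n j)) := \prod_r l (tnth (iset a) r).
have L_lt a : a != a0 -> L a < L a0 by apply: ltr_prod_iset a0E.
have L_gt0 a : 0 < L a by apply: prodr_gt0.
have mapC : map_poly (real_complex R) (char_poly (compound A j))
    = \prod_a ('X - (L a)%:C%:P).
  by rewrite CA rmorph_prod; apply: eq_bigr => a _; rewrite /= map_polyXsubC.
exists (L a0); split => //.
- rewrite /simple_eigenvalue CA (@mup_prod_XsubC _ _ L a0) // => a /L_lt.
  by move=> /lt_eqF ->.
- by rewrite /ceigenvalue mapC (bigD1 a0) //= rootM root_XsubC eqxx.
- move=> mu; rewrite /ceigenvalue mapC rootE horner_prod => /prodf_eq0 [a _].
  rewrite -rootE root_XsubC => /eqP -> aa0; rewrite complex_normE normc_real gtr0_norm // ltcR.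
  by apply: L_lt; apply: contraNneq aa0 => ->.
have LE : L a0 = \prod_(s < j) l (widen_ord hj s) by apply: eq_bigr => s _; rewrite a0E.
have sgn := signs j hj j0; have [wx0 [wy0 _]] := sgn a0.
exists (wedge (first_vecs hj x)), (wedge (first_vecs hj xs)); split => //.
- split; first by apply/cV0Pn; exists a0.
  by rewrite LE; apply: wedge_eigen => s; have [[_ ->]] := eigen (widen_ord hj s).
- split; first by apply/cV0Pn; exists a0.
  rewrite -compound_trmx LE; apply: wedge_eigen => s.
  by have [_ [_ ->]] := eigen (widen_ord hj s).
Qed.

Lemma compound_eventually_SJS n (A : 'M[R]_n) :
  (forall j, (0 < j <= n)%N -> eventually_SJS (compound A j)) -> eventually_STJS A.
Proof.
move=> CA; have {}CA (i : 'I_n) : exists k0, forall k, (k0 <= k)%N -> SJS (compound A i.+1 ^+ k).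
  by apply: CA; rewrite /= ltn_ord.
have [k0 k0P] := fin_all_exists CA.
exists (\max_i k0 i)%N => k kk j /andP [j0 jn]; rewrite compoundX.
case: j j0 jn => // j _ jn; apply: (k0P (Ordinal jn)).
by apply: leq_trans kk; apply: leq_bigmax.
Qed.

End Implications.

(** * From eventual strict total sign-symmetry to total signature equality *)

Lemma trmx_exp (A : comNzRingType) n (M : 'M[A]_n) k : (M ^+ k)^T = M^T ^+ k.
Proof.
by elim: k => [|k IH]; rewrite ?trmx1 // exprS -mulmxE trmx_mul IH mulmxE -exprSr.
Qed.

Section SJSPerron.
Variable R : realType.

(** Conjugation by the signature matrix [D] of [J] makes [B] positive. By uniqueness of Perron
    vectors, [v] and [y] are [D] times nonzero multiples of positive vectors, so their sign patterns
    agree up to one global sign. *)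
Lemma SJS_spectrum m (B : 'M[R]_m) (I : finType) (nu : I -> R[i]) (i0 : 'I_m) :
  SJS B -> map_poly (real_complex R) (char_poly B) = \prod_a ('X - (nu a)%:P) ->
  exists (r : R) (a0 : I),
    [/\ 0 < r, nu a0 = r%:C, (forall a, a != a0 -> normc (nu a) < r) &
        forall v y, is_eigenvector B r v -> is_eigenvector B^T r y ->
          exists2 e : R, e * e = 1 & nozero_same_sign v (e *: y)].
Proof.
move=> [J BJ] Bnu.
pose s i : R := if i \in J then 1 else -1.
have ss i : s i * s i = 1 by rewrite /s; case: ifP => _; ring.
pose D := diag_mx (\row_i s i).
have DD : D *m D = 1%:M.
  apply/matrixP => i k; rewrite mul_diag_mx !mxE; case: eqP => [->|_].
    by rewrite !mulr1n ss.
  by rewrite !mulr0n mulr0.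
have Du : D \in unitmx by case/mulmx1_unit: DD.
have DT : D^T = D by rewrite tr_diag_mx.
pose P := D *m B *m D.
have P0 i k : 0 < P i k.
  rewrite /P /D mul_mx_diag mxE mul_diag_mx mxE !mxE /s.
  by have := BJ i k; case: (i \in J); case: (k \in J) => /=; lra.
have PB : char_poly P = char_poly B.
  by apply: (char_poly_conj (S := D)) => //; rewrite !mulmxA DD mul1mx.
have [r [u [w [a0 [r0 [u0 Pu] [w0 Pw] nua0 nu_lt]]]]] :=
  @perron_spectrum R m P I nu i0 P0 (etrans (congr1 _ PB) Bnu).
exists r, a0; split => // v y [v0 Bv] [y0 By].
have twist (M : 'M[R]_m) (z : 'cV_m) : M *m z = r *: z -> (D *m M *m D) *m (D *m z) = r *: (D *m z).
  by move=> Mz; rewrite -!mulmxA (mulmxA D D) DD mul1mx Mz -scalemxAr.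
have untwist (z q : 'cV[R]_m) c : z != 0 -> D *m z = c *: q ->
    c != 0 /\ forall i, z i 0 = s i * c * q i 0.
  move=> z0 Dz; have zE : z = D *m (c *: q) by rewrite -Dz mulmxA DD mul1mx.
  split=> [|i]; last by rewrite zE mul_diag_mx !mxE mulrA.
  by apply: contraNneq z0 => c0; rewrite zE c0 scale0r mulmx0.
have [c /(untwist _ _ _ v0) [c0 vE]] := perron_unique i0 P0 u0 Pu (twist _ _ Bv).
have PT0 i k : 0 < P^T i k by rewrite mxE.
have PTE : P^T = D *m B^T *m D by rewrite !trmx_mul DT mulmxA.
have PTy : P^T *m (D *m y) = r *: (D *m y) by rewrite PTE; apply: twist.
have [c' /(untwist _ _ _ y0) [c'0 yE]] := perron_unique i0 PT0 w0 Pw PTy.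
(* This sign compensates for the scalars relating [v] and [y] to the two Perron vectors. *)
exists (Num.sg c * Num.sg c').
  by rewrite mulrACA -!expr2 !sqr_sg c0 c'0 mulr1.
have s0 i : s i != 0 by apply/eqP => si; have := ss i; rewrite si mul0r => /eqP; rewrite eq_sym oner_eq0.
move=> i; rewrite mxE vE yE !mulf_neq0 ?sgr_eq0 ?(gt_eqF (u0 _)) ?(gt_eqF (w0 _)) //.
split => //; split => //.
rewrite !sgrM !sgr_id (gtr0_sg (u0 i)) (gtr0_sg (w0 i)) !mulr1.
have cc : Num.sg c' * Num.sg c' = 1 by rewrite -expr2 sqr_sg c'0.
by rewrite mulrCA -mulrA cc mulr1.
Qed.

End SJSPerron.

Section Converse.
Variables (R : realType) (n : nat) (A : 'M[R]_n).

(* The dominant eigenvalue of the [j]-th compound can only be the product [p j] of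
   the [j] eigenvalues of largest modulus; its powers are positive at the
   consecutive exponents [k0] and [k0.+1], so it is positive itself. *)
Lemma eventually_STJS_spectrum : eventually_STJS A ->
  exists (k0 : nat) (l : 'I_n -> R),
    [/\ forall i, 0 < l i, forall i k : 'I_n, (i < k)%N -> l k < l i,
        char_poly A = \prod_i ('X - (l i)%:P) &
        forall j (hj : (j <= n)%N), (0 < j)%N ->
          forall v y, is_eigenvector (compound (A ^+ k0) j) (\prod_r l (widen_ord hj r) ^+ k0) v ->
            is_eigenvector (compound (A ^+ k0) j)^T (\prod_r l (widen_ord hj r) ^+ k0) y ->
          exists2 e : R, e * e = 1 & nozero_same_sign v (e *: y)].
Proof.
move=> [k0 STJS_A]; pose toC := real_complex R.
have [d [Ad d_dec Cd]] := compound_spectrum (map_mx toC A).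
pose p j := \prod_(i < n | (i < j)%N) d i.
have pE j (hj : (j <= n)%N) : p j = \prod_(r < j) d (widen_ord hj r).
  by rewrite /p (big_ord_narrow hj).
pose nu j (a : 'I_(nsets n j)) := \prod_r d (tnth (iset a) r).
have nu0E j (hj : (j <= n)%N) a0 : (forall r, tnth (iset a0) r = widen_ord hj r) ->
    nu j a0 = p j.
  by move=> a0E; rewrite (pE j hj); apply: eq_bigr => r _; rewrite a0E.
have nu_le j (hj : (j <= n)%N) (a : 'I_(nsets n j)) : normc (nu j a) <= normc (p j).
  rewrite (pE j hj) /nu !(big_morph _ (@normcM R) (@normc1 R)).
  apply: ler_prod => r _; rewrite normc_ge0 /=; apply: d_dec.
  exact: leq_iset.
have dom k j (hj : (j <= n)%N) (a0 : 'I_(nsets n j)) : (k0 <= k)%N -> (0 < j)%N ->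
    (forall r, tnth (iset a0) r = widen_ord hj r) ->
    exists r : R, [/\ 0 < r, p j ^+ k = r%:C,
      (forall a, a != a0 -> normc (nu j a) ^+ k < r) &
      forall v y, is_eigenvector (compound (A ^+ k) j) r v ->
        is_eigenvector (compound (A ^+ k) j)^T r y ->
        exists2 e : R, e * e = 1 & nozero_same_sign v (e *: y)].
  move=> kk j0 a0E.
  have SJS_C : SJS (compound (A ^+ k) j) by apply: STJS_A => //; rewrite j0.
  have charC : map_poly toC (char_poly (compound (A ^+ k) j))
      = \prod_a ('X - (nu j a ^+ k)%:P).
    by rewrite map_char_poly map_compound map_mxXn Cd.
  have [r [a1 [r0 nua1 nu_lt eig]]] := SJS_spectrum a0 SJS_C charC.
  (* If another index were dominant, [p j ^+ k] would have modulus below that of [nu j a1 ^+ k],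
     contrary to [nu_le]. *)
  have a01 : a0 = a1.
    apply/eqP; apply: contraT => /nu_lt; rewrite normcX (nu0E _ hj) // => lt_r.
    have := lerXn2r k (normc_ge0 _) (normc_ge0 _) (nu_le j hj a1).
    by rewrite -normcX nua1 normc_real gtr0_norm // leNgt lt_r.
  exists r; split => //.
    by rewrite -nua1 -a01 (nu0E _ hj).
  by move=> a aa0; rewrite -normcX; apply: nu_lt; rewrite -a01.
have p_pos j : (j <= n)%N -> exists2 q : R, 0 < q & p j = q%:C.
  case: (posnP j) => [-> _|j0 hj].
    by exists 1; rewrite ?ltr01 // /p big_pred0.
  have [a0 a0E] := iset_first hj.
  have [r [r0 pr _ _]] := dom k0 j hj a0 (leqnn _) j0 a0E.
  have [r' [r'0 pr' _ _]] := dom k0.+1 j hj a0 (leqnSn _) j0 a0E.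
  exists (r' / r); first by rewrite divr_gt0.
  have rC : r%:C != 0 by rewrite fmorph_eq0 gt_eqF.
  apply: (mulfI rC); rewrite -pr -exprSr pr' pr -rmorphM /=.
  by rewrite mulrCA mulfV ?mulr1 // gt_eqF.
have pS (i : 'I_n) : p i.+1 = p i * d i.
  rewrite /p (bigD1 i) //= mulrC; congr (_ * _); apply: eq_bigl => k.
  by rewrite ltnS -val_eqE ltn_neqAle andbC.
(* [d i] is the quotient of the positive reals [p i.+1] and [p i], with [p 0 = 1]. *)
have d_pos (i : 'I_n) : exists2 l : R, 0 < l & d i = l%:C.
  have [q q0 pq] := p_pos i (ltnW (ltn_ord i)).
  have [q' q'0 pq'] := p_pos i.+1 (ltn_ord i).
  exists (q' / q); first by rewrite divr_gt0.
  have qC : q%:C != 0 by rewrite fmorph_eq0 gt_eqF.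
  apply: (mulfI qC); rewrite -pq -pS pq' pq -rmorphM /=.
  by rewrite mulrCA mulfV ?mulr1 // gt_eqF.
have [l l0 dl] := fin_all_exists2 d_pos.
exists k0, l; split => //.
- move=> i k ik; rewrite ltNge; apply/negP => lik.
  have hj := ltn_ord i.
  have [a0 a0E] := iset_first hj.
  (* The first [i + 1] indices with [i] replaced by [k]. If [l i <= l k], the product over this set
     would be at least the strictly dominant one. *)
  pose f (r : 'I_i.+1) : 'I_n := if (r < i)%N then widen_ord hj r else k.
  have [|a aE] := @iset_of_mono n i.+1 f.
    move=> r s rs; have ri : (r < i)%N by apply: leq_trans rs (leq_ord s).
    by rewrite /f ri; case: ifP => //= _; apply: ltn_trans ri ik.
  have aa0 : a != a0.
    apply/eqP => aa0; have := aE ord_max; rewrite aa0 a0E /f /= ltnn => /(congr1 val) /= ik'.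
    by rewrite -ik' ltnn in ik.
  have [r [r0 pr nu_lt _]] := dom k0 i.+1 hj a0 (leqnn _) isT a0E.
  have nua : nu _ a = p i * d k.
    rewrite /nu big_ord_recr /= aE /f /= ltnn; congr (_ * _).
    rewrite (pE i (ltnW (ltn_ord i))); apply: eq_bigr => s _.
    by rewrite aE /f /= ltn_ord; congr (d _); apply: val_inj.
  have := nu_lt a aa0; rewrite nua -[r]gtr0_norm // -normc_real -pr normcX pS.
  rewrite ltNge => /negP; apply; apply: lerXn2r; rewrite ?nnegrE ?normc_ge0 // !normcM.
  by rewrite ler_wpM2l ?normc_ge0 // !dl !normc_real !gtr0_norm.
- apply: (map_poly_inj toC); rewrite map_char_poly Ad rmorph_prod.
  by apply: eq_bigr => i _; rewrite /= map_polyXsubC dl.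
move=> j hj j0.
have [a0 a0E] := iset_first hj.
have [r [r0 pr _ eig]] := dom k0 j hj a0 (leqnn _) j0 a0E.
suff -> : \prod_r l (widen_ord hj r) ^+ k0 = r by [].
apply: complexI; rewrite -pr (pE j hj) rmorph_prod -prodrXl.
by apply: eq_bigr => s _; rewrite /= rmorphXn /= dl.
Qed.

Lemma eventually_STJS_total_signature_equality :
  eventually_STJS A -> total_signature_equality A.
Proof.
move=> /eventually_STJS_spectrum [k0 [l [l0 l_dec Al eig]]].
have l_inj := decreasing_inj l_dec.
have l_simple i : simple_eigenvalue A (l i).
  rewrite /simple_eigenvalue Al (@mup_prod_XsubC _ _ l i) // => k ki.
  by rewrite (inj_eq l_inj).
have l_root i : root (char_poly A) (l i) by rewrite Al (bigD1 i) //= rootM root_XsubC eqxx.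
have [x x0 Ax] := fin_all_exists2 (fun i => elimT (root_char_polyP A (l i)) (l_root i)).
have l_rootT i : root (char_poly A^T) (l i) by rewrite char_poly_trmx.
have [y y0 Ay] := fin_all_exists2 (fun i => elimT (root_char_polyP A^T (l i)) (l_rootT i)).
(* The wedge of the first [j] eigenvectors is the column [a0] of [compound Z j], which is invertible
   because [Z] is. *)
have wedge_n0 (B : 'M[R]_n) (z : 'I_n -> 'cV[R]_n) j (hj : (j <= n)%N) :
    (forall i, z i != 0) -> (forall i, B *m z i = l i *: z i) -> wedge (first_vecs hj z) != 0.
  move=> z0 Bz; pose Z := \matrix_(i, k) z k i 0.
  have colZ i : col i Z = z i by apply/colP => k; rewrite !mxE.
  have Zu : Z \in unitmx.
    by apply: (eigenvectors_unitmx (A := B) (l := l)) => // i; rewrite colZ.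
  have [a0 a0E] := iset_first hj.
  have CZ : compound (invmx Z) j *m compound Z j = 1%:M.
    by rewrite -compound_mul mulVmx // compound1.
  apply/eqP => w0; have := congr1 (fun M : 'M__ => M a0 a0) CZ; rewrite [RHS]mxE eqxx mxE big1.
    by move/eqP; rewrite eq_sym oner_eq0.
  move=> b _; have := congr1 (fun v : 'cV__ => v b 0) w0; rewrite [RHS]mxE => wb.
  suff -> : compound Z j b a0 = 0 by rewrite mulr0.
  rewrite -wb wedgeE compoundE; congr (\det _).
  by apply/matrixP => r s; rewrite !mxE a0E.
have eigw (B : 'M[R]_n) (z : 'I_n -> 'cV[R]_n) j (hj : (j <= n)%N) :
    (forall i, z i != 0) -> (forall i, B *m z i = l i *: z i) ->
    is_eigenvector (compound (B ^+ k0) j) (\prod_r l (widen_ord hj r) ^+ k0)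
      (wedge (first_vecs hj z)).
  move=> z0 Bz; split; first exact: (wedge_n0 B).
  apply: (wedge_eigen (c := fun r => l (widen_ord hj r) ^+ k0)) => s.
  by apply: mulmx_eigenX; apply: Bz.
have signs (i : 'I_n) : exists e : R, e * e = 1 /\
    nozero_same_sign (wedge (first_vecs (ltn_ord i) x))
      (e *: wedge (first_vecs (ltn_ord i) y)).
  have AT : (compound (A ^+ k0) i.+1)^T = compound (A^T ^+ k0) i.+1.
    by rewrite -compound_trmx trmx_exp.
  have [|e ee sgn] := eig _ (ltn_ord i) isT _ (wedge (first_vecs (ltn_ord i) y))
    (eigw A x _ _ x0 Ax).
    by rewrite AT; apply: eigw.
  by exists e.
have [e eP] := fin_all_exists signs.
(* [g j] is the sign relating the wedges of the first [j] vectors, with [g 0 = 1]; the value beyond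
   [n] is a default. Scaling [y i] by [g i * g i.+1] multiplies the wedge of the first [j] by a
   product that telescopes to [g j]. *)
pose g j : R := if j is i.+1 then (if insub i is Some o then e o else 1) else 1.
have gg j : g j * g j = 1.
  case: j => [|i] /=; first by rewrite mulr1.
  by case: insubP => [o _ _|_]; rewrite ?mulr1 //; have [] := eP o.
have g_tel j : \prod_(s < j) (g s * g s.+1) = g j.
  elim: j => [|j IH]; first by rewrite big_ord0.
  by rewrite big_ord_recr /= IH mulrA gg mul1r.
exists l, x, (fun i : 'I_n => (g i * g i.+1) *: y i); split => //.
  move=> i; split; first by split.
  split; last by rewrite -scalemxAr Ay !scalerA mulrC.
  rewrite scaler_eq0 negb_or y0 andbT.
  apply/eqP => g0; have : (g i * g i.+1) * (g i * g i.+1) = 1 by rewrite mulrACA !gg mulr1.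
  by rewrite g0 mul0r => /eqP; rewrite eq_sym oner_eq0.
case=> [//|j] hj _.
have -> : wedge (first_vecs hj (fun i : 'I_n => (g i * g i.+1) *: y i))
        = g j.+1 *: wedge (first_vecs hj y).
  by rewrite -g_tel -wedge_scale.
rewrite /= insubT /=.
have [_] := eP (Ordinal hj).
have -> // : ltn_ord (Ordinal hj) = hj by apply: eq_irrelevance.
Qed.

End Converse.

Theorem theorem13 (R : realType) (n : nat) (A : 'M[R]_n) :
  [<-> total_signature_equality A;
       forall j : nat, (0 < j <= n)%N -> signature_equality (compound A j);
       forall j : nat, (0 < j <= n)%N -> eventually_SJS (compound A j);
       eventually_STJS A].
Proof.
tfae.
- exact: total_signature_equality_compound.
- by move=> CA j hj; apply/signature_equality_eventually_SJS/CA.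
- exact: compound_eventually_SJS.
- exact: eventually_STJS_total_signature_equality.
Qed.
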